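(* Let $d\ge2$ be an even integer and $g_c(z)=z^d+c$, $c\in\mathbb R$. Then the positively oriented transversality condition holds at every $c_1\in\mathbb R$ for which the critical point $0$ has a finite orbit under $g_{c_1}$, that is, $$\frac{R'(c_1)}{Dg_{c_1}^{q-1}(c_1)}>0,$$ and the topological entropy of $g_c$ depends monotonically on $c\in\mathbb R$.
   Context: For $c_1\in\mathbb R$ such that $0$ is periodic under $g_{c_1}$ with exact period $q$, $R(w)=g_w^{q-1}(w)$. For $c_1\in\mathbb R$ such that $0$ is not periodic and $g_{c_1}^q(0)=g_{c_1}^l(0)$ with $1\le l<q$, $R(w)=g_w^{q-1}(w)-g_w^{l-1}(w)$. Here $w$ is near $c_1$, and $Dg_{c_1}^{q-1}$ is the derivative in $z$. The topological entropy of $g_c:\mathbb R\to\mathbb R$ is that of its continuous extension to the compact interval $[-\infty,+\infty]$. *)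

(* Defs.v *)
From mathcomp Require Import all_boot all_order all_algebra.
From mathcomp Require Import all_classical all_reals all_analysis.

Set Implicit Arguments.
Unset Strict Implicit.
Unset Printing Implicit Defensive.

Import Order.TTheory GRing.Theory Num.Theory.
Import numFieldNormedType.Exports.
Local Open Scope classical_set_scope.
Local Open Scope ring_scope.

Section Dynamics.
Variable T : Type.
Implicit Types (f : T -> T) (x : T).

Definition periodic_point f x := exists2 n, (0 < n)%N & iter n f x = x.

Definition exact_period f x (q : nat) :=
  [/\ (0 < q)%N, iter q f x = x
    & forall n, (0 < n < q)%N -> iter n f x <> x].

Definition forward_orbit f x : set T := range (fun n => iter n f x).

End Dynamics.

(* Topological entropy of Adler, Konheim and McAndrew:
     h(f) = sup_U lim_n (1/n) log N(U \/ f^-1 U \/ ... \/ f^-(n-1) U)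
   over the open covers U, N(V) being the least cardinality of a subcover of V.
   It is meant for a continuous self-map of a nonempty compact space: there N
   is finite and positive and the limit exists. *)
Section TopologicalEntropy.
Variables (R : realType) (T : topologicalType).
Implicit Types (U V : set (set T)) (f : T -> T).

Definition open_cover U := U `<=` open /\ cover U id = [set: T].

Definition cover_number U : \bar R :=
  ereal_inf [set n%:R%:E | n in [set n : nat |
    exists V, [/\ V `<=` U, (V #= `I_n)%card & cover V id = [set: T]]]].

(* The common refinement of the covers f^-i U for i < n. *)
Definition iterated_cover f U (n : nat) : set (set T) :=
  [set \bigcap_(i in `I_n) (iter i f @^-1` A i) |
    A in [set A : nat -> set T | forall i, (i < n)%N -> U (A i)]].

Definition cover_entropy f U : \bar R :=
  limn (fun n => (n%:R^-1)%:E * lne (cover_number (iterated_cover f U n)))%E.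

Definition topological_entropy f : \bar R :=
  ereal_sup [set cover_entropy f U | U in open_cover].

End TopologicalEntropy.

Arguments topological_entropy R {T} f.

Section UnicriticalFamily.
Variable R : realType.
Implicit Types (d q l : nat) (c z : R).

Definition g d c z : R := z ^+ d + c.

Definition R_periodic d q (w : R) : R := iter q.-1 (g d w) w.

Definition R_preperiodic d l q (w : R) : R :=
  iter q.-1 (g d w) w - iter l.-1 (g d w) w.

Definition transversality_quotient d c1 q (Rfun : R -> R) : R :=
  derive1 Rfun c1 / derive1 (iter q.-1 (g d c1)) c1.

Definition positively_transversal d c1 :=
  (forall q, exact_period (g d c1) 0 q ->
     0 < transversality_quotient d c1 q (R_periodic d q)) /\
  (~ periodic_point (g d c1) 0 ->
   forall l q, (1 <= l < q)%N -> iter q (g d c1) 0 = iter l (g d c1) 0 ->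
     0 < transversality_quotient d c1 q (R_preperiodic d l q)).

(* The extension of g d c to [-oo, +oo]: for d even and positive, g d c tends
   to +oo at both ends (see g_ext_continuous and g_ext_unique). *)
Definition g_ext d c (x : \bar R) : \bar R :=
  if x is z%:E then (g d c z)%:E else +oo%E.

End UnicriticalFamily.

Section ExtensionFacts.
Variable R : realType.
Implicit Types (d : nat) (c z : R).

Lemma g_ge d c (M z : R) : (0 < d)%N -> ~~ odd d ->
  1 <= `|z| -> `|M - c| <= `|z| -> M <= g d c z.
Proof.
move=> d0 de z1 zM; rewrite /g -lerBlDr (le_trans (ler_norm _))//.
rewrite (le_trans zM)// -[leRHS]ger0_norm ?exprn_even_ge0// normrX.
by rewrite ler_eXnr.
Qed.

Lemma g_ext_continuous d c : (0 < d)%N -> ~~ odd d -> continuous (g_ext d c).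
Proof.
move=> d0 de.
have gM (M : R) (z : R) : Num.max 1 `|M - c| <= `|z| ->
    (M%:E <= g_ext d c z%:E)%E.
  by rewrite lee_fin ge_max => /andP[z1 zM]; exact: g_ge.
case=> [z| |].
- have gz : (g d c y)%:E @[y --> z] --> (g d c z)%:E.
    apply: cvg_EFin; first exact: nearW.
    by apply: cvgD; [exact: exprn_continuous|exact: cvg_cst].
  by move=> A /gz zA; apply/nbhs_EFin.
- apply/(@cvgeyPge _ _ (nbhs (+oo%E : \bar R)) _ (g_ext d c)) => M.
  apply: filterS (ereal_nbhs_pinfty_ge (num_real (Num.max 1 `|M - c|))).
  case=> [x| |]; [|by move=> _; rewrite /= leey..].
  by rewrite lee_fin => /le_trans xM; apply/gM/xM/ler_norm.
- apply/(@cvgeyPge _ _ (nbhs (-oo%E : \bar R)) _ (g_ext d c)) => M.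
  apply: filterS (ereal_nbhs_ninfty_le (num_real (- Num.max 1 `|M - c|))).
  case=> [x| |]; [|by move=> _; rewrite /= leey..].
  rewrite lee_fin lerNr => /le_trans xM.
  by apply: gM; rewrite -(normrN x); apply/xM/ler_norm.
Qed.

Lemma g_ext_unique d c (G : \bar R -> \bar R) : (0 < d)%N -> ~~ odd d ->
  continuous G -> (forall z, G z%:E = (g d c z)%:E) -> G = g_ext d c.
Proof.
move=> d0 de Gc GE; apply/funext => x.
have Fc := @g_ext_continuous d c d0 de.
have pin : EFin x @[x --> +oo%R] --> (+oo%E : \bar R).
  by apply/cvgeryP; exact: cvg_id.
have nin : EFin x @[x --> -oo%R] --> (-oo%E : \bar R).
  by apply/cvgerNyP; exact: cvg_id.
have EG : G \o EFin = g_ext d c \o EFin by apply/funext => z /=; rewrite GE.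
case: x => [z| |]; first by rewrite GE.
- have h1 := cvg_comp EFin G pin (Gc +oo%E).
  have h2 := cvg_comp EFin (g_ext d c) pin (Fc +oo%E).
  by rewrite EG in h1; exact: cvg_unique h1 h2.
- have h1 := cvg_comp EFin G nin (Gc -oo%E).
  have h2 := cvg_comp EFin (g_ext d c) nin (Fc -oo%E).
  by rewrite EG in h1; exact: cvg_unique h1 h2.
Qed.

End ExtensionFacts.

(* Main.v *)
Require Import Defs.
From mathcomp Require Import all_boot all_order all_algebra.
From mathcomp Require Import all_solvable all_field.
From mathcomp Require Import all_classical all_reals all_analysis.
From mathcomp Require Import complex polyrcf zify ring lra.

(**
   Transversality.  Write x_i = g_c^i(0), and suppose x_q = x_l, where l = 0 if
   0 is periodic.  For real t let V_0 = 0, V_(i+1) = 1 + t d x_i^(d-1) V_i.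
   Then V_i is the c-derivative of g_c^i(0) when t = 1, and
   G(s) = s^(q-1) (V_q - V_l), taken at t = 1/s, is a polynomial in s whose
   value at 0 is Dg^(q-1)(c).  It suffices that G has no zero in ]0, 1].

   At s = 1 this is arithmetic (Gleason): c is an algebraic integer and V_i is
   congruent to 1 modulo d.  For s < 1 a zero of G is an eigenvector (V_i) of
   eigenvalue t > 1 for the linearised pull-back
   x_i |-> (x_(i+1) - x_1)^(1/d).  Following Levin, Shen and van Strien, move
   the points x_i holomorphically over the unit disc with velocity (V_i): as
   long as the points do not collide, the motion lifts under the pull-back to
   a motion over the same disc, with the same bound, and each lift multiplies
   the velocity by t.  This contradicts Cauchy's estimate.  Holomorphic
   functions are replaced by polynomials over R[i], the d-th root of a
   polynomial without zeros in the disc being approximated by multiplying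
   truncated binomial series.

   Entropy.  A preimage of 0 under g_c^k is given by the word of the signs of
   the inverse branches z = +- (w - c)^(1/d).  By transversality, a preimage
   that meets the critical value c does so downwards as c grows, so every word
   realised at c' is realised at each c <= c', and the number of turning points
   of g_c^n decreases with c.  An open cover refined by a finite set of real
   points has n-th cover number bounded by a multiple of n times this number;
   conversely the cover by the intervals around the turning points of g_c^m
   has (mn)-th cover number at least 3^(-n) times it.  Letting n, then m, tend
   to infinity gives the monotonicity of the entropy.
*)

Set Implicit Arguments.
Unset Strict Implicit.
Unset Printing Implicit Defensive.

Import Order.TTheory GRing.Theory Num.Theory.
Import numFieldNormedType.Exports.
Local Open Scope classical_set_scope.
Local Open Scope ring_scope.

(** * Polynomials on the closed unit disc *)

Section ClosedFieldPolynomials.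
Variable C : numClosedFieldType.
Implicit Types (p q : {poly C}) (x e s M : C).

(** In characteristic 0 the polynomial X^n - 1 is separable, and n distinct n-th roots of unity
    include a primitive one. *)
Lemma closed_prim_root_exists n : (0 < n)%N -> exists w : C, n.-primitive_root w.
Proof.
move=> n_gt0; have [r Dr] := closed_field_poly_normal ('X^n - 1 : {poly C}).
move: Dr; rewrite (monicP _) ?monicXnsubC // scale1r => Dr.
have Xn0 : size ('X^n - 1 : {poly C}) = n.+1 by rewrite size_XnsubC.
have rn1 : all n.-unity_root r by apply/allP=> z; rewrite -root_prod_XsubC -Dr.
have sr : (n <= size r)%N.
  by rewrite -ltnS -Xn0 Dr size_prod_XsubC.
have Ur : uniq r.
  rewrite -separable_prod_XsubC -Dr separable_Xn_sub_1 //.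
  by rewrite pnatr_eq0 -lt0n.
by have /hasP[w _ wn] := has_prim_root n_gt0 rn1 Ur sr; exists w.
Qed.

(* Averaging p(w^j) / w^j over the n-th roots of unity isolates the linear
   coefficient as soon as n > deg p. *)
Lemma linear_coef_bound p M :
  (forall x, `|x| <= 1 -> `|p.[x]| <= M) -> `|p`_1| <= M.
Proof.
(* For [k < size p], the exponent [k + n.-1] is a multiple of [n] only when k = 1; the factor
   [w ^+ (j * n.-1)] below stands for w^(-j). *)
move=> pM; pose n := (size p).+2.
have n0 : (0 < n)%N by [].
have [w pw] := closed_prim_root_exists n0.
have wn1 : w ^+ n = 1 := prim_expr_order pw.
have w1 : `|w| = 1.
  by apply/eqP; rewrite -(@pexpr_eq1 _ _ n) // -normrX wn1 normr1.
have key : \sum_(j < n) p.[w ^+ j] * w ^+ (j * n.-1) = n%:R * p`_1.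
  under eq_bigr => j _ do rewrite horner_coef mulr_suml.
  rewrite exchange_big /=.
  have E (k : 'I_(size p)) :
    \sum_(j < n) p`_k * w ^+ j ^+ k * w ^+ (j * n.-1) =
    if k == 1%N :> nat then n%:R * p`_1 else 0.
    have -> : \sum_(j < n) p`_k * w ^+ j ^+ k * w ^+ (j * n.-1) =
              p`_k * \sum_(j < n) (w ^+ (k + n.-1)) ^+ j.
      rewrite mulr_sumr; apply: eq_bigr => j _.
      by rewrite -mulrA -!exprM -exprD; congr (_ * _ ^+ _); rewrite mulnDl (mulnC k) (mulnC n.-1).
    have kn : (k < size p)%N := ltn_ord k.
    case: eqP => [k1|k1].
      rewrite k1 add1n /= wn1 mulrC; congr (_ * _).
      under eq_bigr => j _ do rewrite expr1n.
      by rewrite sumr_const card_ord.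
    apply/eqP; rewrite mulf_eq0; apply/orP; right.
    have a1 : w ^+ (k + n.-1) != 1.
      rewrite -(prim_order_dvd pw).
      have [k0|k0] := posnP k.
        by rewrite k0 add0n /n /=; apply/negP => /dvdn_leq; rewrite ltnn => /(_ isT).
      have -> : (k + n.-1 = n + k.-1)%N by rewrite -[in LHS](prednK k0) addSnnS /n /= addnC.
      rewrite dvdn_addr // gtnNdvd //; last by rewrite /n; lia.
      by move: k0 k1; case: (k : nat) => [//|[//|m]].
    have := subrX1 (w ^+ (k + n.-1)) n.
    rewrite -exprM mulnC exprM wn1 expr1n subrr => /esym/eqP.
    by rewrite mulf_eq0 subr_eq0 (negbTE a1).
  rewrite (eq_bigr _ (fun k _ => E k)).
  have [sp|sp] := ltnP 1 (size p).
    rewrite (bigD1 (Ordinal sp)) //= big1 ?addr0 // => i.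
    by rewrite -val_eqE /= => /negbTE ->.
  rewrite (nth_default 0 sp) mulr0 big1 // => i _.
  by case: eqP.
have : `|n%:R * p`_1| <= n%:R * M.
  rewrite -key (le_trans (ler_norm_sum _ _ _)) //.
  have -> : n%:R * M = \sum_(j < n) M by rewrite sumr_const card_ord mulr_natl.
  apply: ler_sum => j _.
  by rewrite normrM !normrX w1 !expr1n mulr1 pM // normrX w1 expr1n.
by rewrite normrM normr_nat ler_pM2l // ltr0n.
Qed.

(* A root-free or zero-at-the-origin-only polynomial is a product of factors
   x and x - a with |a| > 1. *)
Lemma poly_lower_bound p : p != 0 ->
    (forall x, 0 < `|x| <= 1 -> p.[x] != 0) ->
  exists e k, 0 < e /\ forall x, `|x| <= 1 -> e * `|x| ^+ k <= `|p.[x]|.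
Proof.
move=> p0; have [r Dp] := closed_field_poly_normal p.
rewrite Dp => rp.
have lc0 : 0 < `|lead_coef p| by rewrite normr_gt0 lead_coef_eq0.
have rr a : a \in r -> a = 0 \/ 1 < `|a|.
  move=> ar; have [->|a0] := eqVneq a 0; [by left|right].
  rewrite real_ltNge ?normr_real ?real1 //; apply/negP => a1.
  have /negP : (lead_coef p *: \prod_(z <- r) ('X - z%:P)).[a] != 0.
    by apply: rp; rewrite normr_gt0 a0.
  apply; rewrite hornerZ mulf_eq0; apply/orP; right.
  by have := root_prod_XsubC r a; rewrite /root ar => ->.
suff [e [k [e0 ek]]] : exists e k, 0 < e /\ forall x, `|x| <= 1 ->
    e * `|x| ^+ k <= `|(\prod_(z <- r) ('X - z%:P)).[x]|.
  exists (`|lead_coef p| * e), k; split; first exact: mulr_gt0.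
  by move=> x x1; rewrite hornerZ normrM -mulrA ler_pM2l // ek.
elim: r {Dp rp} rr => [|a r IH] rr.
  exists 1, 0%N; split => // x _.
  by rewrite big_nil expr0 mulr1 hornerC normr1.
have [|e [k [e0 ek]]] := IH; first by move=> b br; apply: rr; rewrite inE br orbT.
have [->|a1] := rr a (mem_head _ _).
  exists e, k.+1; split=> // x x1.
  rewrite big_cons hornerM !hornerE normrM exprS mulrCA subr0.
  by rewrite ler_wpM2l // ek.
exists ((`|a| - 1) * e), k; split; first by rewrite mulr_gt0 // subr_gt0.
move=> x x1; rewrite big_cons hornerM !hornerE normrM -mulrA.
apply: ler_pM.
- by rewrite subr_ge0 ltW.
- by rewrite mulr_ge0 ?exprn_ge0 // ltW.
- by rewrite distrC (le_trans _ (lerB_dist _ _)) // lerB.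
- exact: ek.
Qed.

Lemma poly_upper_bound p : exists2 M, 0 < M & forall x, `|x| <= 1 -> `|p.[x]| <= M.
Proof.
exists (1 + \sum_(i < size p) `|p`_i|).
  by rewrite ltr_pwDl // sumr_ge0.
move=> x x1; rewrite horner_coef (le_trans (ler_norm_sum _ _ _)) //.
rewrite ler_wpDl // ler_sum // => i _.
by rewrite normrM normrX ler_piMr // exprn_ile1.
Qed.

End ClosedFieldPolynomials.

(** * Approximate d-th roots of polynomials *)

Section ApproximateRoots.
Variables (C : numClosedFieldType) (d : nat).
Hypothesis d_gt0 : (0 < d)%N.
(** The form in which the archimedean property is used; for complex numbers it is
    [complex_expr_small]. *)
Hypothesis expr_small :
  forall s e : C, 0 <= s < 1 -> 0 < e -> exists n, s ^+ n <= e.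
Implicit Types (P Q F S : {poly C}) (x e s : C).

(* The Taylor coefficients of (1 - z)^(1/d). *)
Definition rootc (k : nat) : C := \prod_(i < k) ((i%:R - d%:R^-1) / i.+1%:R).

Definition root_trunc N : {poly C} := \poly_(k < N.+1) rootc k.

Lemma rootcS k : k.+1%:R * rootc k.+1 = (k%:R - d%:R^-1) * rootc k.
Proof.
by rewrite /rootc big_ord_recr /= mulrC -mulrA divfK ?pnatr_eq0 // mulrC.
Qed.

Lemma norm_rootc k : `|rootc k| <= 1.
Proof.
rewrite /rootc normr_prod; apply: prodr_ile1 => i _.
rewrite normr_ge0 normrM normfV !normr_nat ler_pdivrMr ?ltr0n // mul1r.
rewrite (le_trans (ler_normB _ _)) // normfV !normr_nat -natr1 lerD2l.
by rewrite invf_le1 ?ler1n ?ltr0n.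
Qed.

(** The full series B of (1 - z)^(1/d) solves (1 - z) B' + B / d = 0; cutting it after degree N
    leaves only a term of degree N on the right. *)
Lemma root_trunc_ode N :
  (root_trunc N)^`() * (1 - 'X) + d%:R^-1 *: root_trunc N =
  ((d%:R^-1 - N%:R) * rootc N) *: 'X^N.
Proof.
apply/polyP=> k; rewrite mulrBr mulr1 coefD coefB coefZ coefZ coefMX coefXn.
rewrite !coef_deriv !coef_poly -[_ *+ k.+1]mulr_natl.
case: k => [|k] /=.
  rewrite subr0; case: N => [|N] /=; first by rewrite mulr0 add0r mulr1 subr0.
  by rewrite (rootcS 0) !mulr0 sub0r mulNr addNr.
rewrite !ltnS -[_ *+ k.+1]mulr_natl.
case: (ltngtP k.+1 N) => [kN|kN|<-].
- by rewrite rootcS mulr0; ring.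
- by rewrite !mulr0 subr0 add0r.
- by rewrite mulr0 mulr1; ring.
Qed.

(** Let Y be the d-th power. By [root_trunc_ode], (1 - z) Y' + Y vanishes below degree N, so (j + 1)
    Y_(j+1) = (j - 1) Y_j for j < N; from Y_0 = 1 the coefficients up to N are 1, -1, 0, 0, and so
    on. *)
Lemma root_trunc_pow N k : (k <= N)%N -> (0 < N)%N ->
  ((root_trunc N) ^+ d)`_k = (1 - 'X : {poly C})`_k.
Proof.
set B := root_trunc N; set Y := B ^+ d => kN N0.
have dC : d%:R != 0 :> C by rewrite pnatr_eq0 -lt0n.
have ode : Y^`() * (1 - 'X) + Y =
    (d%:R * ((d%:R^-1 - N%:R) * rootc N)) *: (B ^+ d.-1 * 'X^N).
  have dY : Y^`() = d%:R *: (B^`() * B ^+ d.-1).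
    by rewrite /Y deriv_exp scaler_nat.
  have EY : Y = d%:R *: (B ^+ d.-1 * (d%:R^-1 *: B)).
    by rewrite -scalerAr scalerA mulfV // scale1r mulrC -exprS prednK.
  rewrite dY [in X in _ + X]EY -scalerA -scalerAl -scalerDr; congr (_ *: _).
  by rewrite scalerAr -root_trunc_ode -/B; ring.
have rec j : (j < N)%N -> j.+1%:R * Y`_j.+1 = (j%:R - 1) * Y`_j.
  move=> jN; have := congr1 (fun p : {poly C} => p`_j) ode.
  rewrite mulrBr mulr1 coefD coefB coefZ coefMX coefMXn jN mulr0.
  rewrite !coef_deriv -[_ *+ j.+1]mulr_natl.
  case: j jN => [|j] jN /= => [|H].
    by rewrite subr0 sub0r mulN1r => /eqP; rewrite addr_eq0 => /eqP.
  move/eqP: H; rewrite -addrA addr_eq0 => /eqP ->.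
  by rewrite -[_ *+ j.+1]mulr_natl; ring.
have Y0 : Y`_0 = 1.
  rewrite -horner_coef0 horner_exp horner_coef0 coef_poly /=.
  by rewrite /rootc big_ord0 expr1n.
have jC (j : nat) : j.+1%:R != 0 :> C by rewrite pnatr_eq0.
elim: k kN => [|[|k] IH] kN; rewrite coefB coef1 coefX /=.
- by rewrite Y0 subr0.
- by apply: (mulfI (jC 0%N)); rewrite rec // Y0 !mulr1 !sub0r mul1r.
- apply: (mulfI (jC k.+1)); rewrite rec // IH ?(ltnW kN) //.
  rewrite coefB coef1 coefX /=; case: k {IH kN} => [|k] /=.
    by rewrite mulr1n subrr mul0r subr0 mulr0.
  by rewrite subr0 !mulr0.
Qed.

Lemma dominated_coefM P Q P1 Q1 : (forall k, `|P`_k| <= P1`_k) ->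
  (forall k, `|Q`_k| <= Q1`_k) -> forall k, `|(P * Q)`_k| <= (P1 * Q1)`_k.
Proof.
move=> h1 h2 k; rewrite !coefM (le_trans (ler_norm_sum _ _ _)) //.
by apply: ler_sum => i _; rewrite normrM ler_pM.
Qed.

Lemma dominated_coefX P P1 n : (forall k, `|P`_k| <= P1`_k) ->
  forall k, `|(P ^+ n)`_k| <= (P1 ^+ n)`_k.
Proof.
move=> h; elim: n => [|n IH] k.
  by rewrite !expr0 coef1 normr_nat.
by rewrite !exprS; apply: dominated_coefM.
Qed.

(** The error is a multiple of ['X^K] because points of a motion may meet at the origin: near it the
    error must be small against their distance. *)
Definition approx_root P := forall K e, 0 < e ->
  exists S F, [/\ S.[0] = 1, S ^+ d = P + 'X^K * F
    & forall x, `|x| <= 1 -> `|F.[x]| <= e].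

(** Substitute [b *: 'X] into a long truncation B. The coefficients of [B ^+ d - (1 - 'X)] vanish up
    to degree N and are dominated by those of the d-th power of a truncated geometric series. *)
Lemma approx_root_linear (b : C) : `|b| < 1 -> approx_root (1 - b *: 'X).
Proof.
move=> b1 K e e0; pose s : C := `|b|.
(* The geometric majorant is evaluated at a [t] strictly between [|b|] and 1; the ratio [s / t] < 1
   then supplies the smallness. *)
have [t [st t1]] : exists t : C, s < t /\ t < 1.
  by exists ((s + 1) / 2); split; rewrite midf_lt.
have t0 : 0 < t by rewrite (le_lt_trans _ st) // /s.
have [||n Hn] := @expr_small (s / t) (e * (t ^+ K * (1 - t) ^+ d)).
- by rewrite divr_ge0 ?normr_ge0 ?(ltW t0) //= ltr_pdivrMr // mul1r.
- by apply: mulr_gt0 => //; apply: mulr_gt0; apply: exprn_gt0; rewrite ?subr_gt0.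
(* As N exceeds K + n, the error starts beyond degree K, and each surviving index has k >= n, so
   that (s / t)^k <= (s / t)^n. *)
pose N := (K + n).+1; pose B := root_trunc N.
pose E := B ^+ d - (1 - 'X); pose F := \poly_(k < size E) E`_(k + K).
have EF : E = 'X^K * F.
  apply/polyP=> k; rewrite coefXnM coef_poly.
  case: ltnP => kK.
    rewrite coefB root_trunc_pow ?subrr // /N; lia.
  rewrite subnK //; case: ltnP => // sk.
  by rewrite nth_default // (leq_trans sk) // leq_subr.
pose G := \poly_(k < N.+1) (1 : C).
have BG k : `|B`_k| <= G`_k.
  by rewrite !coef_poly; case: ifP => _; rewrite ?normr0 ?norm_rootc.
have EG k : `|E`_k| <= (G ^+ d)`_k.
  have [kN|kN] := leqP k N.
    rewrite coefB root_trunc_pow // subrr normr0.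
    exact: le_trans (normr_ge0 _) (dominated_coefX d BG k).
  rewrite coefB [X in _ - X](_ : _ = 0) ?subr0 ?dominated_coefX //.
  by rewrite coefB coef1 coefX /N in kN *; case: k kN => [|[|k]] //= _; rewrite subr0.
have Gt : (G ^+ d).[t] <= ((1 - t) ^+ d)^-1.
  rewrite horner_exp -exprVn lerXn2r ?nnegrE ?invr_ge0 ?subr_ge0 ?(ltW t1) //.
    rewrite horner_poly sumr_ge0 // => i _; rewrite mul1r exprn_ge0 // ltW //.
  rewrite horner_poly; under eq_bigr do rewrite mul1r.
  have := subrX1 t N.+1; rewrite -opprB -[t - 1]opprB mulNr => /oppr_inj H.
  rewrite -[leRHS]mul1r ler_pdivlMr ?subr_gt0 // mulrC -H.
  by rewrite gerBl exprn_ge0 // ltW.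
have bX : (b *: 'X : {poly C}).[0] = 0 by rewrite !hornerE.
exists (B \Po (b *: 'X)), (b ^+ K *: (F \Po (b *: 'X))); split.
- rewrite horner_comp bX horner_coef0 coef_poly /=.
  by rewrite /rootc big_ord0.
- rewrite -rmorphXn /=.
  have -> : B ^+ d = (1 - 'X) + E by rewrite /E addrC subrK.
  rewrite comp_polyD comp_polyB comp_polyC comp_polyX; congr (_ + _).
  rewrite EF comp_polyM rmorphXn /= comp_polyX exprZn.
  by rewrite -scalerAl -scalerAr.
- move=> x x1; rewrite hornerZ horner_comp !hornerE.
  rewrite normrM normrX -/s.
  have s1 : s <= 1 by rewrite ltW.
  apply: (@le_trans _ _ `|F.[b * x]|).
    by rewrite ler_piMl // exprn_ile1 // /s.
  apply: (@le_trans _ _ (\sum_(k < size E) (s / t) ^+ n / t ^+ K * ((G ^+ d)`_(k + K) * t ^+ (k + K)))).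
    rewrite horner_poly (le_trans (ler_norm_sum _ _ _)) //.
    apply: ler_sum => k _.
    rewrite normrM normrX normrM -/s.
    have G0 : 0 <= (G ^+ d)`_(k + K) by exact: le_trans (EG _).
    have [kN|kN] := leqP (k + K) N.
      rewrite coefB root_trunc_pow // subrr normr0 mul0r.
      by rewrite mulr_ge0 ?divr_ge0 ?mulr_ge0 ?exprn_ge0 ?divr_ge0 ?(ltW t0) // /s.
    rewrite exprD.
    have -> : (s / t) ^+ n / t ^+ K * ((G ^+ d)`_(k + K) * (t ^+ k * t ^+ K)) =
       (G ^+ d)`_(k + K) * ((s / t) ^+ n * t ^+ k).
      by field; rewrite expf_neq0 // gt_eqF.
    apply: ler_pM => //.
      by rewrite exprn_ge0 // mulr_ge0 // /s.
    apply: (@le_trans _ _ (s ^+ k)).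
      rewrite lerXn2r ?nnegrE ?mulr_ge0 // /s //.
      by rewrite ler_piMr.
    have -> : s ^+ k = (s / t) ^+ k * t ^+ k.
      by rewrite -exprMn divfK // gt_eqF.
    rewrite ler_wpM2r ?exprn_ge0 ?(ltW t0) //.
    apply: ler_wiXn2l; last by move: kN; rewrite /N; clear; lia.
      by rewrite divr_ge0 ?(ltW t0) // /s.
    by rewrite ler_pdivrMr // mul1r ltW.
  rewrite -mulr_sumr.
  have tail : \sum_(k < size E) (G ^+ d)`_(k + K) * t ^+ (k + K) <= (G ^+ d).[t].
    have Gd0 k : 0 <= (G ^+ d)`_k * t ^+ k.
      by rewrite mulr_ge0 ?exprn_ge0 ?(ltW t0) // (le_trans _ (EG _)).
    have szG : (size (G ^+ d) <= K + (size E + size (G ^+ d)))%N.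
      by rewrite addnA leq_addl.
    rewrite (horner_coef_wide _ szG) big_split_ord /= addrC.
    rewrite big_split_ord /= -addrA.
    apply: ler_wpDr; first by rewrite addr_ge0 ?sumr_ge0.
    by apply: ler_sum => i _; rewrite addnC.
  apply: (@le_trans _ _ ((s / t) ^+ n / t ^+ K * ((1 - t) ^+ d)^-1)).
    apply: ler_wpM2l; last exact: le_trans tail Gt.
    by rewrite mulr_ge0 ?invr_ge0 ?exprn_ge0 ?divr_ge0 ?(ltW t0) // /s.
  rewrite -mulrA -invfM ler_pdivrMr //.
  by apply: mulr_gt0; apply: exprn_gt0; rewrite ?subr_gt0.
Qed.

Lemma approx_rootM P Q : approx_root P -> approx_root Q -> approx_root (P * Q).
Proof.
move=> hP hQ K e e0.
have [MP MP0 HP] := poly_upper_bound P.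
have [MQ MQ0 HQ] := poly_upper_bound Q.
have D0 : 0 < MP + MQ + 1 + e by rewrite !addr_gt0.
(* This [r] satisfies r <= 1 and (MP + MQ + 1) r <= e, which also absorbs the product of the two
   errors. *)
pose r := e / (MP + MQ + 1 + e).
have r0 : 0 < r by rewrite divr_gt0.
have r1 : r <= 1.
  by rewrite ler_pdivrMr // mul1r ler_wpDl // ?addr_ge0 // ltW.
have [S1 [F1 [S10 S1d F1e]]] := hP K r r0.
have [S2 [F2 [S20 S2d F2e]]] := hQ K r r0.
exists (S1 * S2), (P * F2 + Q * F1 + 'X^K * F1 * F2); split.
- by rewrite hornerM S10 S20 mulr1.
- by rewrite exprMn S1d S2d; ring.
- move=> x x1; rewrite !hornerD !hornerM !hornerE.
  apply: (@le_trans _ _ (MP * r + MQ * r + 1 * r * r)).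
    rewrite (le_trans (ler_normD _ _)) // lerD //.
      rewrite (le_trans (ler_normD _ _)) // lerD // normrM ler_pM ?HP ?HQ ?F1e ?F2e //.
    rewrite !normrM ler_pM ?mulr_ge0 ?F2e // ler_pM ?F1e //.
    by rewrite normrX exprn_ile1.
  apply: (@le_trans _ _ ((MP + MQ + 1) * r)).
    by rewrite mul1r !mulrDl mul1r lerD2l ler_piMr // ltW.
  rewrite /r mulrA ler_pdivrMr // mulrC ler_wpM2l ?(ltW e0) //.
  by rewrite ler_wpDr // ltW.
Qed.

(** All roots a of P lie outside the closed disc and [P.[0] = 1], so P is a product of factors 1 - X
    / a, each covered by [approx_root_linear]. *)
Lemma approx_root_exists P : P.[0] = 1 ->
  (forall x, `|x| <= 1 -> P.[x] != 0) -> approx_root P.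
Proof.
move=> P1 P0; have [r Dp] := closed_field_poly_normal P.
have lc0 : lead_coef P != 0.
  by rewrite lead_coef_eq0; apply/eqP => Pz; move/eqP: P1; rewrite Pz horner0 eq_sym oner_eq0.
have rr a : a \in r -> 1 < `|a|.
  move=> ar; rewrite real_ltNge ?normr_real ?real1 //; apply/negP => a1.
  have := P0 a a1; rewrite Dp hornerZ mulf_eq0 negb_or => /andP[_ /negP]; apply.
  by have := root_prod_XsubC r a; rewrite /root ar => ->.
have -> : P = \prod_(a <- r) (1 - a^-1 *: 'X).
  rewrite Dp; have : P.[0] = lead_coef P * \prod_(a <- r) (- a).
    rewrite {1}Dp hornerZ horner_prod; congr (_ * _).
    by apply: eq_bigr => a _; rewrite hornerXsubC sub0r.
  rewrite P1 => lcE.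
  have -> : \prod_(z <- r) ('X - z%:P) = (\prod_(a <- r) (- a)) *: \prod_(a <- r) (1 - a^-1 *: 'X).
    elim: r rr {Dp lcE} => [|a r IH] rr; first by rewrite !big_nil scale1r.
    rewrite !big_cons IH; last by move=> b br; apply: rr; rewrite inE br orbT.
    have a0 : a != 0 by rewrite -normr_gt0 (lt_trans _ (rr a (mem_head _ _))).
    have -> : 'X - a%:P = (- a) *: (1 - a^-1 *: 'X).
      by rewrite scalerBr scalerA mulNr mulfV // !scaleNr scale1r opprK addrC alg_polyC.
    by rewrite -scalerAl -scalerAr scalerA.
  by rewrite scalerA -lcE scale1r.
elim: r rr {Dp} => [|a r IH] rr.
  rewrite big_nil => K e e0; exists 1, 0; split; rewrite ?hornerC //.
    by rewrite expr1n mulr0 addr0.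
  by move=> x _; rewrite horner0 normr0 ltW.
rewrite big_cons; apply: approx_rootM; last first.
  by apply: IH => b br; apply: rr; rewrite inE br orbT.
have a1 := rr a (mem_head _ _).
by apply: approx_root_linear; rewrite normfV invf_lt1 // (lt_trans _ a1).
Qed.

End ApproximateRoots.

(** * Lifting polynomial motions *)

Section Lifting.
Variables (C : numClosedFieldType) (d : nat).
Hypothesis d_ge2 : (2 <= d)%N.
Hypothesis expr_small :
  forall s e : C, 0 <= s < 1 -> 0 < e -> exists n, s ^+ n <= e.
(** A finite critical orbit in abstract form: [sg] is the successor on indices, [z (sg 0)] is the
    critical value, and [zE] says that g maps [z i] to [z (sg i)]. *)
Variables (q : nat) (sg : nat -> nat) (z : nat -> C).
Hypothesis sg_lt : forall i, (i < q)%N -> (sg i < q)%N.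
Hypothesis z0 : z 0%N = 0.
Hypothesis z_neq0 : forall i, (i < q)%N -> (0 < i)%N -> z i != 0.
Hypothesis zE : forall i, (i < q)%N -> z i ^+ d = z (sg i) - z (sg 0%N).
Hypothesis z_opp : forall i j, (i < q)%N -> (j < q)%N ->
  z i ^+ d = z j ^+ d -> z i = z j \/ z i = - z j.
Implicit Types (p : nat -> {poly C}) (M x t : C).

Lemma uniform_lower_bound (Ps : seq {poly C}) :
  (forall P, P \in Ps -> P != 0 -> forall x, 0 < `|x| <= 1 -> P.[x] != 0) ->
  exists (e : C) k, 0 < e /\ forall P, P \in Ps -> P != 0 ->
    forall x, `|x| <= 1 -> e * `|x| ^+ k <= `|P.[x]|.
Proof.
elim: Ps => [|P Ps IH] H; first by exists 1, 0%N.
have [|e [k [e0 ek]]] := IH; first by move=> Q QPs; apply: H; rewrite inE QPs orbT.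
have [->|P0] := eqVneq P 0.
  exists e, k; split => // Q; rewrite inE => /orP[/eqP->|]; last exact: ek.
  by rewrite eqxx.
have [e' [k' [e'0 ek']]] := poly_lower_bound P0 (H P (mem_head _ _) P0).
have D0 : 0 < e + e' by rewrite addr_gt0.
have pw x (m m' : nat) : `|x| <= 1 -> (m <= m')%N -> `|x| ^+ m' <= `|x| ^+ m.
  by move=> x1 mm; apply: ler_wiXn2l.
(* The number e e' / (e + e') lies below both constants and replaces their minimum. *)
exists (e * e' / (e + e')), (k + k')%N; split; first by rewrite divr_gt0 ?mulr_gt0.
move=> Q; rewrite inE => /orP[/eqP->|QPs] Q0 x x1.
  apply: le_trans (ek' x x1); apply: ler_pM => //.
  - by rewrite divr_ge0 ?mulr_ge0 ?ltW.
  - by rewrite ler_pdivrMr // mulrC ler_pM2l // lerDl ltW.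
  - by rewrite pw // leq_addl.
apply: le_trans (ek Q QPs Q0 x x1); apply: ler_pM => //.
- by rewrite divr_ge0 ?mulr_ge0 ?ltW.
- by rewrite ler_pdivrMr // ler_pM2l // lerDr ltW.
- by rewrite pw // leq_addr.
Qed.

(** Turns the absence of collisions into a quantitative margin, against which the errors of the
    approximate roots are compared. *)
Lemma uniform_separation p :
  (forall i j, (i < q)%N -> (j < q)%N -> p i != p j ->
    forall x, 0 < `|x| <= 1 -> (p i).[x] != (p j).[x]) ->
  exists (e : C) k, 0 < e /\ forall i j, (i < q)%N -> (j < q)%N -> p i != p j ->
    forall x, `|x| <= 1 -> e * `|x| ^+ k <= `|(p i - p j).[x]|.
Proof.
move=> sep; pose Ps := [seq p i - p j | i <- iota 0 q, j <- iota 0 q].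
have [|e [k [e0 ek]]] := @uniform_lower_bound Ps.
  move=> P /allpairsP[[i j] /= []]; rewrite !mem_iota add0n => iq jq -> P0 x x01.
  by rewrite hornerD hornerN subr_eq0 sep // -subr_eq0.
exists e, k; split => // i j iq jq pij; apply: ek; last by rewrite subr_eq0.
by apply/allpairsP; exists (i, j); rewrite !mem_iota !add0n.
Qed.

(* Distinct indices may carry the same point z; the corresponding p then meet
   at the origin and either coincide or separate outside it. *)
Definition motion M p := [/\ p 0%N = 0,
  forall i, (i < q)%N -> (p i).[0] = z i,
  forall i, (i < q)%N -> forall x, `|x| <= 1 -> `|(p i).[x]| <= M
  & forall i j, (i < q)%N -> (j < q)%N -> p i != p j ->
    forall x, 0 < `|x| <= 1 -> (p i).[x] != (p j).[x]].

(** The difference D_i = p_(sg i) - p_(sg 0) starts at z_i^d and, when z_i is nonzero, has no zero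
    in the disc, so z_i times an approximate root of D_i / z_i^d lifts the motion. If two lifts
    collide, D_i and D_j are closer than the separation margin, hence equal; the lifts are then
    equal or opposite, and opposite ones would meet at 0, from which D_i is bounded away. *)
Lemma motion_lift M p : 3 <= M -> motion M p ->
  exists p', motion M p' /\ forall i, (i < q)%N ->
    (p' i)`_1 = ((p (sg i))`_1 - (p (sg 0%N))`_1) / (d%:R * z i ^+ d.-1).
Proof.
move=> M3 [p0 pz pM sep].
have M0 : 0 < M by rewrite (lt_le_trans _ M3) // ltr0n.
have d0 : (0 < d)%N by exact: ltnW.
have [e [k [e0 ek]]] := uniform_separation sep.
have e3 : 0 < e + 3 by rewrite addr_gt0 // ltr0n.
(* This choice gives eta <= 1, for the bound M, and 2 eta < e, for the separation. *)
pose eta := e / (e + 3).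
have eta0 : 0 < eta by rewrite divr_gt0.
have eta1 : eta <= 1 by rewrite ler_pdivrMr // mul1r lerDl ler0n.
have eta2 : eta + eta < e.
  rewrite /eta -mulrDl ltr_pdivrMr // (_ : e + e = e * 2); last by ring.
  rewrite ltr_pM2l //.
  by rewrite ltr_wpDl ?(ltW e0) // ltr_nat.
pose D i := p (sg i) - p (sg 0%N).
have zM i : (i < q)%N -> `|z i| <= M.
  by move=> iq; rewrite -pz // pM // normr0 ler01.
have D0 i : (i < q)%N -> (D i).[0] = z i ^+ d.
  move=> iq; rewrite hornerD hornerN !pz ?zE //; last exact: sg_lt.
  by apply: sg_lt; apply: leq_ltn_trans iq.
have Dlow i x : (i < q)%N -> z i != 0 -> `|x| <= 1 -> e * `|x| ^+ k <= `|(D i).[x]|.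
  move=> iq zi x1; have q0 : (0 < q)%N by apply: leq_ltn_trans iq.
  apply: ek => //; [exact: sg_lt|exact: sg_lt|].
  rewrite -subr_eq0; apply: contraNneq zi => Di0.
  by move: (D0 i iq); rewrite /D Di0 horner0 => /esym/eqP; rewrite expf_eq0 d0.
(* The root is chosen as a function of the polynomial, so that indices with the same normalised D
   share it. The order [k.+2] of the error covers the separation order [k] and leaves the linear
   coefficient untouched. *)
have /choice[S HS] : forall P : {poly C}, exists S : {poly C}, P.[0] = 1 ->
    (forall x, `|x| <= 1 -> P.[x] != 0) ->
    exists F : {poly C}, [/\ S.[0] = 1, S ^+ d = P + 'X^(k.+2) * F
      & forall x, `|x| <= 1 -> `|F.[x]| <= eta / M ^+ d].
  move=> P; have [[P1 Pn]|nP] := pselect (P.[0] = 1 /\ (forall x, `|x| <= 1 -> P.[x] != 0)).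
    have ee : 0 < eta / M ^+ d by rewrite divr_gt0 // exprn_gt0.
    have [S [F SF]] := approx_root_exists d0 expr_small P1 Pn k.+2 ee.
    by exists S => _ _; exists F.
  by exists 0 => P1 Pn; case: nP.
pose P i := (z i ^+ d)^-1 *: D i.
pose p' i := z i *: S (P i).
have Hp' i : (i < q)%N -> z i != 0 -> exists F : {poly C}, [/\ (S (P i)).[0] = 1,
    p' i ^+ d = D i + 'X^(k.+2) * F & forall x, `|x| <= 1 -> `|F.[x]| <= eta].
  move=> iq zi.
  have zd : z i ^+ d != 0 by rewrite expf_neq0.
  have [||F [S0 Sd SF]] := HS (P i).
  - by rewrite hornerZ D0 // mulVf.
  - move=> x x1; rewrite hornerZ mulf_neq0 ?invr_eq0 //.
    have [->|xn0] := eqVneq x 0; first by rewrite D0.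
    rewrite -normr_gt0 (lt_le_trans _ (Dlow _ _ iq zi x1)) //.
    by rewrite mulr_gt0 // exprn_gt0 // normr_gt0.
  exists (z i ^+ d *: F); split => //.
    by rewrite exprZn Sd scalerDr /P scalerA mulfV // scale1r scalerAr.
  move=> x x1; rewrite hornerZ normrM.
  rewrite (le_trans (ler_pM _ _ (lexx _) (SF x x1))) //.
  rewrite mulrCA ler_piMr ?(ltW eta0) // normrX ler_pdivrMr ?exprn_gt0 // mul1r.
  by rewrite lerXn2r ?nnegrE ?zM // ltW.
have z00 i : z i = 0 -> p' i = 0 by move=> zi; rewrite /p' zi scale0r.
have err i x : (i < q)%N -> `|x| <= 1 -> `|(p' i).[x] ^+ d - (D i).[x]| <= eta * `|x| ^+ k.
  move=> iq x1; have [zi|zi] := eqVneq (z i) 0.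
    have Di0 : D i = 0.
      case: i iq zi => [|i] iq zi; first exact: subrr.
      by have := z_neq0 iq isT; rewrite zi eqxx.
    rewrite z00 // Di0 !horner0 expr0n gtn_eqF // subr0 normr0.
    by rewrite mulr_ge0 ?(ltW eta0) // exprn_ge0.
  have [F [_ pd Fe]] := Hp' i iq zi.
  rewrite -horner_exp pd hornerD [X in `|X|](_ : _ = 'X^(k.+2).[x] * F.[x]); last first.
    by rewrite addrC addKr hornerM.
  rewrite hornerXn normrM mulrC normrX.
  apply: ler_pM; rewrite ?Fe ?exprn_ge0 //.
  by apply: ler_wiXn2l => //; rewrite -addn2 leq_addr.
exists p'; split; last first.
  (* At the critical point both sides are 0: [p' i] is 0, and so is the divisor, whose inverse is 0
     by convention. *)
  move=> i iq; have [zi|zi] := eqVneq (z i) 0.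
    by rewrite z00 // coef0 zi expr0n gtn_eqF ?mulr0 ?invr0 ?mulr0 // -ltnS prednK.
  have [F [S0 pd _]] := Hp' i iq zi.
  have := congr1 (fun P : {poly C} => (P^`()).[0]) pd.
  rewrite deriv_exp hornerMn hornerM horner_exp derivD hornerD.
  rewrite !horner_coef0 !coef_deriv !mulr1n coefXnM /= addr0 coefB.
  rewrite -[(p' i)`_0]horner_coef0 hornerZ S0 mulr1 => <-.
  rewrite -[_ *+ d]mulr_natl mulrCA mulfK //.
  by rewrite mulf_neq0 ?expf_neq0 // pnatr_eq0 -lt0n.
split.
- exact: z00.
- move=> i iq; have [zi|zi] := eqVneq (z i) 0; first by rewrite z00 // horner0 zi.
  by have [F [S0 _ _]] := Hp' i iq zi; rewrite hornerZ S0 mulr1.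
- move=> i iq x x1.
  have q0 : (0 < q)%N by apply: leq_ltn_trans iq.
  (* Comparing d-th powers: 1 + 2 M <= 3 M <= M^2 <= M^d, the reason for 3 <= M. *)
  rewrite -(@ler_pXn2r _ d) ?nnegrE ?(ltW M0) // -normrX.
  have -> : (p' i).[x] ^+ d = ((p' i).[x] ^+ d - (D i).[x]) + (D i).[x] by rewrite subrK.
  rewrite (le_trans (ler_normD _ _)) //.
  apply: (@le_trans _ _ (1 + (M + M))).
    rewrite lerD //.
      rewrite (le_trans (err i x iq x1)) // mulr_ile1 ?(ltW eta0) ?exprn_ge0 //.
      by rewrite exprn_ile1.
    rewrite hornerD hornerN (le_trans (ler_normB _ _)) // lerD // pM ?sg_lt //.
  apply: (@le_trans _ _ (M * M)).
    apply: (@le_trans _ _ (3 * M)); last by rewrite ler_pM2r.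
    have -> : 3 * M = M + (M + M) by ring.
    by rewrite lerD2r (le_trans _ M3) // ler1n.
  rewrite -expr2; apply: ler_weXn2l => //.
  by rewrite (le_trans _ M3) // ler1n.
- move=> i j iq jq pij x /andP[x0 x1]; apply/negP => /eqP xij.
  have xk : 0 < `|x| ^+ k by rewrite exprn_gt0.
  have Dij : `|(D i - D j).[x]| <= (eta + eta) * `|x| ^+ k.
    have -> : (D i - D j).[x] =
      ((p' j).[x] ^+ d - (D j).[x]) - ((p' i).[x] ^+ d - (D i).[x]).
      by rewrite hornerD hornerN xij; ring.
    by rewrite (le_trans (ler_normB _ _)) // mulrDl lerD // err.
  have [pp|pp] := eqVneq (p (sg i)) (p (sg j)); last first.
    have := le_lt_trans Dij (_ : _ < e * `|x| ^+ k).
    rewrite ltr_pM2r // => /(_ eta2).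
    have -> : D i - D j = p (sg i) - p (sg j) by rewrite /D; ring.
    rewrite real_ltNge ?realE ?normr_ge0 ?mulr_ge0 ?exprn_ge0 ?(ltW e0) //.
    by rewrite ek // sg_lt.
  have DD : D i = D j by rewrite /D pp.
  have zz : z i ^+ d = z j ^+ d by rewrite -!D0 // DD.
  have PP : P i = P j by rewrite /P DD zz.
  have [zij|zij] := z_opp iq jq zz.
    by move: pij; rewrite /p' zij PP eqxx.
  have zi : z i != 0.
    apply: contraNneq pij => zi; rewrite z00 // z00 //.
    by apply/eqP; rewrite -oppr_eq0 -zij zi.
  have pi0 : (p' i).[x] = 0.
    have : (p' i).[x] = - (p' j).[x] by rewrite !hornerZ PP zij mulNr.
    rewrite -xij => /eqP; rewrite -addr_eq0 -mulr2n mulrn_eq0 /=.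
    by move=> /eqP.
  have := err i x iq x1; rewrite pi0 expr0n gtn_eqF // sub0r normrN.
  move=> /(le_trans (Dlow _ _ iq zi x1)); rewrite ler_pM2r // => ee.
  have : eta < e by rewrite (le_lt_trans _ eta2) // lerDl ltW.
  by rewrite real_ltNge ?ee // realE ltW.
Qed.

Section ExpandingVector.
Variables (t : C) (v : nat -> C).
Hypothesis t_gt1 : 1 < t.
Hypothesis v0 : v 0%N = 0.
(** Thus [v] is an eigenvector of the linearised lift: the velocity formula of [motion_lift]
    multiplies it by [t]. *)
Hypothesis v_eigen : forall i, (i < q)%N ->
  v (sg i) - v (sg 0%N) = t * (d%:R * z i ^+ d.-1) * v i.

Lemma linear_motion : exists M a, [/\ 3 <= M, 0 < a & exists2 p, motion M p &
  forall i, (i < q)%N -> (p i)`_1 = a * v i].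
Proof.
have [|e [k [e0 ek]]] := @uniform_separation (fun i => (z i)%:P).
  move=> i j iq jq zij x _; rewrite !hornerC.
  by apply: contraNneq zij => ->.
pose L := 1 + \sum_(i < q) `|v i|.
have vL i : (i < q)%N -> `|v i| < L.
  move=> iq; rewrite /L (bigD1 (Ordinal iq)) //= addrCA ltrDl.
  by rewrite ltr_wpDr // sumr_ge0.
have L0 : 0 < L by rewrite ltr_wpDr // sumr_ge0.
have LL : 0 < L + L by rewrite addr_gt0.
(* Distinct points [z i] are at distance at least [e], and [L] exceeds all [|v i|], so at this speed
   distinct points do not meet in the unit disc. *)
have [a [a0 aE]] : exists a : C, 0 < a /\ a * (L + L) = e.
  by exists (e / (L + L)); rewrite divr_gt0 // divfK ?gt_eqF.
pose M := 3 + \sum_(i < q) `|z i| + a * L.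
have M3 : 3 <= M.
  by rewrite /M -addrA lerDl addr_ge0 ?sumr_ge0 // mulr_ge0 ?ltW.
exists M, a; split => //.
exists (fun i => (z i)%:P + (a * v i) *: 'X); last first.
  by move=> i iq; rewrite coefD coefC coefZ coefX /= add0r mulr1.
split=> [||i iq x x1|i j iq jq pij x /andP[x0 x1]].
- by rewrite z0 v0 mulr0 scale0r addr0.
- by move=> i iq; rewrite !hornerE.
- rewrite !hornerE (le_trans (ler_normD _ _)) // lerD //.
    apply: ler_wpDl => //; rewrite (bigD1 (Ordinal iq)) //= lerDl.
    by rewrite sumr_ge0.
  rewrite !normrM (gtr0_norm a0) -mulrA ler_pM2l //.
  apply: le_trans (ltW (vL i iq)).
  by rewrite ler_piMr.
- have [zij|zij] := eqVneq (z i) (z j).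
    rewrite !hornerE zij; apply: contraNneq pij => /addrI/mulIf E.
    by rewrite zij E // -normr_gt0.
  rewrite -subr_eq0 !hornerE.
  have -> : z i + a * v i * x - (z j + a * v j * x) =
    (z i - z j) - (a * (v j - v i) * x) by ring.
  rewrite subr_eq0; apply/eqP => E.
  have zc : (z i)%:P != (z j)%:P by apply: contra zij => /eqP/polyC_inj ->.
  have := ek i j iq jq zc 1; rewrite normr1 lexx expr1n mulr1 => /(_ isT).
  rewrite -polyCB hornerC E !normrM (gtr0_norm a0) => eE.
  have : a * `|v j - v i| * `|x| < e.
    apply: (@le_lt_trans _ _ (a * `|v j - v i|)).
      by rewrite ler_piMr // mulr_ge0 // ltW.
    rewrite -[in ltRHS]aE ltr_pM2l //.
    by rewrite (le_lt_trans (ler_normB _ _)) // ltrD ?vL.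
  by move=> /(le_lt_trans eE); rewrite ltxx.
Qed.

Lemma iterated_motion : exists M a, [/\ 3 <= M, 0 < a & forall n, exists2 p, motion M p &
  forall i, (i < q)%N -> (p i)`_1 = a * t ^+ n * v i].
Proof.
have [M [a [M3 a0 [p pm pv]]]] := linear_motion; exists M, a; split => //.
elim=> [|n [p1 p1m p1v]]; first by exists p => // i iq; rewrite mulr1 pv.
have [p2 [p2m p2v]] := motion_lift M3 p1m; exists p2 => // i iq.
have q0 : (0 < q)%N by apply: leq_ltn_trans iq.
rewrite p2v // !p1v ?sg_lt // -mulrBr v_eigen //.
case: i iq => [|i] iq; first by rewrite v0 !mulr0 mul0r.
have zi : z i.+1 != 0 by exact: z_neq0.
have dC : d%:R != 0 :> C by rewrite pnatr_eq0 -lt0n ltnW.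
rewrite exprS; have := expf_neq0 d.-1 zi; move: (z i.+1 ^+ d.-1) => w w0.
by field; rewrite w0 dC.
Qed.

(** The linear coefficients a t^n v_i of the iterated lifts stay below the common bound M by
    [linear_coef_bound], while t^n is unbounded. *)
Lemma no_expanding_vector i : (i < q)%N -> v i = 0.
Proof.
move=> iq; have [M [a [M3 a0 H]]] := iterated_motion.
apply/eqP; apply/negPn/negP => vi.
have M0 : 0 < M by rewrite (lt_le_trans _ M3) // ltr0n.
have t0 : 0 < t by rewrite (lt_trans _ t_gt1).
have av : 0 < a * `|v i| by rewrite mulr_gt0 // normr_gt0.
have [||n Hn] := @expr_small t^-1 (a * `|v i| / (M + M)).
- by rewrite invr_ge0 ltW //= invf_lt1.
- by rewrite divr_gt0 // addr_gt0.
have [p [_ _ pM _] pv] := H n.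
have := linear_coef_bound (pM i iq); rewrite pv // !normrM normrX.
rewrite (gtr0_norm a0) (gtr0_norm t0) mulrAC => Hb.
move: Hn; rewrite exprVn ler_pdivlMr ?addr_gt0 // mulrC ler_pdivrMr ?exprn_gt0 //.
move=> /le_trans/(_ Hb); rewrite -subr_ge0 opprD addrA subrr sub0r oppr_ge0.
by move=> /(lt_le_trans M0); rewrite ltxx.
Qed.

End ExpandingVector.

End Lifting.

(** * Transversality *)

Section IntegralElements.
Variable R : numFieldType.
Local Notation integral := (integralOver (intr : int -> R)).

(** Clearing denominators in a monic integer equation for 1 / m gives 1 + m a = 0 with an integer a,
    so m divides 1. *)
Lemma integral_inv_nat m : (0 < m)%N -> integral (m%:R^-1) -> m = 1%N.
Proof.
move=> m0 [p pm /eqP].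
have mR : m%:R != 0 :> R by rewrite pnatr_eq0 -lt0n.
have sp : size (map_poly (intr : int -> R) p) = size p.
  by apply: size_map_poly_id0; rewrite (monicP pm) oner_eq0.
rewrite horner_coef sp.
have p0 : (0 < size p)%N by rewrite lt0n size_poly_eq0 monic_neq0.
have {p0}[n sn] : exists n, size p = n.+1 by exists (size p).-1; rewrite prednK.
have pn : p`_n = 1 by have := monicP pm; rewrite /lead_coef sn.
rewrite sn big_ord_recr /= coef_map pn mul1r => /(congr1 ( *%R (m%:R ^+ n))).
rewrite mulr0 mulrDr -exprMn mulfV // expr1n mulr_sumr.
have -> : \sum_(i < n) m%:R ^+ n * ((map_poly (intr : int -> R) p)`_i * m%:R^-1 ^+ i) =
   (m%:Z * \sum_(i < n) p`_i * m%:Z ^+ (n.-1 - i))%:~R.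
  rewrite mulr_sumr rmorph_sum /=; apply: eq_bigr => i _.
  rewrite coef_map /= !rmorphM rmorphXn /= -pmulrn mulrCA [RHS]mulrCA; congr (_ * _).
  rewrite -exprS exprVn -expfB //.
  by congr (_ ^+ _); move: (ltn_ord i); clear; lia.
set a := (m%:Z * _) => /eqP.
rewrite -[X in _ + X]/((1 : int)%:~R) -rmorphD /= intr_eq0 => /eqP H.
have : (m%:Z %| 1)%Z.
  apply/dvdzP; exists (- \sum_(i < n) p`_i * m%:Z ^+ (n.-1 - i)).
  by rewrite mulNr mulrC; apply/eqP; rewrite -addr_eq0 addrC H.
by rewrite dvdz1 => /eqP.
Qed.

(** Otherwise 1 / m = -u would be integral. This is how a congruence to 1 modulo m yields
    non-vanishing. *)
Lemma integral_natD_neq0 m u : (1 < m)%N -> integral u -> 1 + m%:R * u != 0.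
Proof.
move=> m1 uint; apply/eqP => /eqP; rewrite addr_eq0 => /eqP E.
have m0 : (0 < m)%N by exact: ltnW.
have mR : m%:R != 0 :> R by rewrite pnatr_eq0 -lt0n.
have : integral (m%:R^-1).
  suff -> : m%:R^-1 = - u by apply: integral_opp.
  by apply: (mulfI mR); rewrite mulfV // mulrN.
by move=> /(integral_inv_nat m0) m_1; rewrite m_1 in m1.
Qed.

End IntegralElements.

(** * The critical orbit and its parameter derivatives *)

Section CriticalOrbit.
Variables (R : realType) (d : nat).
Hypotheses (d_ge2 : (2 <= d)%N) (d_even : ~~ odd d).
Implicit Types (c t : R) (i l q : nat).

Definition crit c i : R := iter i (g d c) 0.

Lemma critS c i : crit c i.+1 = crit c i ^+ d + c. Proof. by []. Qed.

Definition gderiv c i : R := d%:R * crit c i ^+ d.-1.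

Lemma gderiv0 c : gderiv c 0 = 0.
Proof. by rewrite /gderiv /crit /= expr0n gtn_eqF ?mulr0 // -ltnS prednK // ltnW. Qed.

(* For t = 1 this is the derivative of g_c^i(0) with respect to c. *)
Fixpoint param_deriv c t i : R :=
  if i is i'.+1 then 1 + t * gderiv c i' * param_deriv c t i' else 0.

(** By the chain rule this is Dg^(q-1)(c); the index starts at 1 because x_1 = c. *)
Definition orbit_deriv c q : R := \prod_(1 <= i < q) gderiv c i.

(** Both kinds of finite orbit at once: for l = 0 the point 0 has exact period q; l > 0 is the
    preperiodic case, where l and q need not be minimal. *)
Definition critical_relation c l q := [/\ (l < q)%N, crit c q = crit c l
  & forall i, (0 < i < q)%N -> crit c i != 0].

Lemma eq_expr_opp (x y : R) : x ^+ d = y ^+ d -> x = y \/ x = - y.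
Proof.
move=> xy; have : `|x| ^+ d = `|y| ^+ d.
  by rewrite -!normrX xy.
move/eqP; rewrite eqrXn2 ?normr_ge0 //; last exact: ltnW.
by rewrite eqr_norm2 => /orP[] /eqP; [left|right].
Qed.

Lemma complex_expr_small (s e : R[i]) : 0 <= s < 1 -> 0 < e -> exists n, s ^+ n <= e.
Proof.
move=> /andP[s0 s1] e0.
have /complex_realP[r rE] : s \is Num.real by rewrite ger0_real.
have /complex_realP[f fE] : e \is Num.real by rewrite gtr0_real.
move: s0 s1 e0; rewrite rE fE -[0]/(0%:C)%C -[1]/(1%:C)%C lecR !ltcR => r0 r1 f0.
have r1' : `|r| < 1 by rewrite ger0_norm.
have /cvgr0Pnorm_le/(_ f f0)[N _ HN] := cvg_expr r1'.
exists N; rewrite -rmorphXn /= lecR -[leLHS]ger0_norm ?exprn_ge0 //.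
exact: HN (leqnn N).
Qed.

(** If V_q = V_l, the vector (V_i) closes up along the orbit, and V_(i+1) - V_1 = t g'(x_i) V_i
    makes it an expanding eigenvector; by [no_expanding_vector] it vanishes, although V_1 = 1. *)
Lemma param_deriv_neq c t l q : 1 < t -> critical_relation c l q ->
  param_deriv c t q != param_deriv c t l.
Proof.
move=> t1 [lq xql x0]; apply/eqP => Vql.
pose sg i := if i.+1 == q then l else i.+1.
pose z i : R[i] := (crit c i)%:C%C.
pose v i : R[i] := (param_deriv c t i)%:C%C.
have vsg i : v (sg i) = (param_deriv c t i.+1)%:C%C.
  by rewrite /v /sg; case: eqP => // ->; rewrite Vql.
have zsg i : z (sg i) = (crit c i.+1)%:C%C.
  by rewrite /z /sg; case: eqP => // ->; rewrite xql.
have q0 : (0 < q)%N by apply: leq_ltn_trans lq.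
have sgq i : (i < q)%N -> (sg i < q)%N.
  by rewrite /sg => iq; case: eqP => // /eqP iq1; rewrite ltn_neqAle iq1.
have d0 : (d == 0)%N = false by rewrite gtn_eqF // ltnW.
have : v (sg 0%N) = 0.
  apply: (@no_expanding_vector _ d d_ge2 complex_expr_small q sg z sgq _ _ _ _ t%:C%C v) => //.
  - move=> i iq i0; by rewrite /z fmorph_eq0; apply: x0; rewrite i0.
  - move=> i iq; rewrite !zsg !critS /z -rmorphXn -rmorphB /=.
    by rewrite {2}/crit /= expr0n d0 add0r addrK.
  - move=> i j iq jq; rewrite /z -!rmorphXn /= => /complexI/eq_expr_opp[]->; [by left|right].
    by rewrite rmorphN.
  - by rewrite -[1]/(1%:C)%C ltcR.
  - move=> i iq; rewrite !vsg /v /z /= gderiv0 !mulr0 addr0.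
    rewrite -rmorphXn -[d%:R](rmorph_nat (real_complex R)) -!rmorphM -rmorphB /=; congr (_%:C)%C.
    by rewrite addrC addKr.
  - exact: sgq.
rewrite vsg /= gderiv0 !mulr0 addr0 => /eqP.
by rewrite -[0]/(0%:C)%C => /eqP/complexI/eqP; rewrite oner_eq0.
Qed.

Fixpoint crit_poly i : {poly int} :=
  if i is i'.+1 then crit_poly i' ^+ d + 'X else 0.

Lemma crit_polyP i : crit_poly i.+1 \is monic /\ size (crit_poly i.+1) = (d ^ i).+1.
Proof.
elim: i => [|i [mi si]].
  by rewrite /= expr0n gtn_eqF ?(ltnW d_ge2) // add0r monicX size_polyX.
have sX : size (crit_poly i.+1 ^+ d) = (d ^ i.+1).+1.
  have s0 : (0 < size (crit_poly i.+1 ^+ d)%R)%N.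
    by rewrite lt0n size_poly_eq0 expf_neq0 // monic_neq0.
  by rewrite -(prednK s0) size_exp si /= expnSr.
have sXX : (size ('X : {poly int}) < size (crit_poly i.+1 ^+ d)%R)%N.
  by rewrite size_polyX sX ltnS (leq_trans d_ge2) // expnS leq_pmulr // expn_gt0 ltnW.
rewrite -/(crit_poly i.+1) [crit_poly i.+2]/(crit_poly i.+1 ^+ d + 'X).
rewrite size_polyDl // sX; split => //.
by rewrite monicE lead_coefDl // -monicE monic_exp.
Qed.

Lemma horner_crit_poly c i : (map_poly intr (crit_poly i)).[c] = crit c i.
Proof.
elim: i => [|i IH]; first by rewrite /= rmorph0 horner0.
by rewrite /= rmorphD rmorphXn /= map_polyX hornerD horner_exp hornerX IH.
Qed.

Local Notation integral := (integralOver (intr : int -> R)).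

Section Arithmetic.
Variables (c : R) (l q : nat).
Hypothesis rel : critical_relation c l q.

(** The parameter is a root of [crit_poly q - crit_poly l], which is monic because l < q makes the
    second degree smaller. *)
Lemma integral_param : integral c.
Proof.
have [lq xql _] := rel.
exists (crit_poly q - crit_poly l); last first.
  by rewrite /root rmorphB hornerD hornerN !horner_crit_poly xql subrr.
have [q' qE] : exists q', q = q'.+1 by exists q.-1; rewrite prednK // (leq_ltn_trans _ lq).
rewrite qE in lq *; have [mq sq] := crit_polyP q'.
rewrite monicE lead_coefDl -?monicE // size_polyN sq.
case: l lq => [|l']; first by rewrite size_poly0.
rewrite ltnS => lq; have [_ ->] := crit_polyP l'.
by rewrite ltnS ltn_exp2l.
Qed.

Lemma integral_exp u n : integral u -> integral (u ^+ n).
Proof.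
move=> ui; elim: n => [|n IH]; first exact: integral1.
by rewrite exprS; apply: integral_mul.
Qed.

Lemma integral_crit i : integral (crit c i).
Proof.
elim: i => [|i IH]; first by rewrite /crit /=; exact: mxpoly.integral0.
by rewrite critS; apply: integral_add integral_param; apply: integral_exp.
Qed.

Lemma integral_param_deriv i : integral (param_deriv c 1 i).
Proof.
elim: i => [|i IH] /=; first exact: mxpoly.integral0.
apply: integral_add; first exact: integral1.
rewrite mul1r; apply: integral_mul => //; apply: integral_mul; first exact: integral_nat.
by apply: integral_exp; apply: integral_crit.
Qed.

Lemma param_derivS_mod i : (0 < i)%N ->
  exists2 u, integral u & param_deriv c 1 i = 1 + d%:R * u.
Proof.
case: i => // i _; exists (crit c i ^+ d.-1 * param_deriv c 1 i).
  apply: integral_mul (integral_param_deriv _); apply: integral_exp; exact: integral_crit.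
by rewrite /= mul1r /gderiv mulrA.
Qed.

End Arithmetic.

(* Reducing modulo d in the ring of algebraic integers: the derivatives are
   congruent to 1, and for d = 2 the sum of the two derivatives is divided by
   2 first. *)
Lemma param_deriv_sum_neq0 c l0 q0 l q : critical_relation c l0 q0 ->
  (0 < l < q)%N -> crit c q = - crit c l ->
  param_deriv c 1 q + param_deriv c 1 l != 0.
Proof.
move=> rel /andP[l_gt0 lq] xql.
have ic := integral_crit rel; have iV := integral_param_deriv rel.
have i2 : integral 2 by apply: integral_nat.
case: l l_gt0 lq xql => // l _; case: q => // q; rewrite ltnS => lq xql.
have q_gt0 : (0 < q)%N by apply: leq_ltn_trans lq.
(* Here V_(i+1) = 1 + d w_i. With d = 2 e the sum is 2 (1 + e (w_q + w_l)), and reduction modulo e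
   settles every case but d = 2. *)
pose w i := crit c i ^+ d.-1 * param_deriv c 1 i.
have iw i : integral (w i).
  by apply: integral_mul (iV _); apply: integral_exp; exact: ic.
have -> : param_deriv c 1 q.+1 + param_deriv c 1 l.+1 = 2 + d%:R * (w q + w l).
  by rewrite /= !mul1r /gderiv /w; ring.
have [e dE] : exists e, d = (2 * e)%N.
  by exists d./2; rewrite mul2n -[LHS]odd_double_half (negbTE d_even).
have -> : 2 + d%:R * (w q + w l) = 2 * (1 + e%:R * (w q + w l)).
  by rewrite dE natrM; ring.
rewrite mulf_neq0 ?pnatr_eq0 //.
have [e1|e1] := leqP e 1%N; last first.
  by apply: integral_natD_neq0 => //; apply: integral_add.
have dE1 := dE; have {e1}d2 : d = 2%N by move: e1 dE1 d_ge2; clear; lia.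
clear dE.
have e_1 : e = 1%N by move: dE1 d2; clear; lia.
(* For d = 2, w_i is congruent to x_i modulo 2. *)
have iu i : exists2 u, integral u & w i = crit c i + 2 * u.
  case: i => [|i].
    by exists 0; [exact: mxpoly.integral0|rewrite /w /crit /= !mulr0 addr0].
  exists (crit c i.+1 * w i); first exact: integral_mul.
  by rewrite /w d2 /= !mul1r /gderiv d2 /= !expr1; ring.
have [u1 iu1 ->] := iu q; have [u2 iu2 ->] := iu l; rewrite e_1 mul1r.
apply/eqP => E.
(* A zero sum makes s congruent to 1 modulo 2. But x_(q+1) = -x_(l+1) gives x_q^2 + x_l^2 = -2 c, so
   2 divides s^2. *)
pose s := crit c q + crit c l.
have sE : s = - 1 - 2 * (u1 + u2).
  by apply/eqP; rewrite -subr_eq0 -[X in _ == X]E /s; apply/eqP; ring.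
have s2E : s ^+ 2 = 2 * (crit c q * crit c l - c).
  move: xql; rewrite !critS d2 => /eqP; rewrite -subr_eq0 => /eqP xql.
  rewrite -[LHS]subr0 -xql /s; ring.
have : 1 + 2 * (2 * (u1 + u2) + 2 * (u1 + u2) ^+ 2 - (crit c q * crit c l - c)) = 0.
  have -> : 1 + 2 * (2 * (u1 + u2) + 2 * (u1 + u2) ^+ 2 - (crit c q * crit c l - c)) =
     s ^+ 2 - 2 * (crit c q * crit c l - c) by rewrite sE; ring.
  by rewrite s2E subrr.
apply/eqP/(integral_natD_neq0 (m := 2)) => //.
have i12 : integral (u1 + u2) by apply: integral_add.
apply: integral_sub; last by apply: integral_sub; [exact: integral_mul|exact: integral_param rel].
by apply: integral_add; apply: integral_mul => //; apply: integral_exp.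
Qed.

(** For l = 0, V_q is congruent to 1 modulo d. For l > 0, the preimages satisfy x_(q-1) = x_(l-1) or
    x_(q-1) = -x_(l-1). In the first case V_q - V_l is a nonzero multiple of V_(q-1) - V_(l-1), and
    l decreases; in the second it is one of V_(q-1) + V_(l-1), treated by [param_deriv_sum_neq0]. *)
Lemma param_deriv1_neq c l q : critical_relation c l q ->
  param_deriv c 1 q != param_deriv c 1 l.
Proof.
move=> rel; have rel0 := rel; move: (rel) => [lq xql x0].
have [l0|l_gt0] := posnP l.
  have q_gt0 : (0 < q)%N by rewrite -l0.
  have [u iu ->] := param_derivS_mod rel q_gt0.
  by rewrite l0 integral_natD_neq0.
have x0' i : (0 < i)%N -> (i < q)%N -> crit c i != 0 by move=> i0 iq; rewrite x0 ?i0.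
suff H l' q' : (0 < l' < q')%N -> (q' <= q)%N -> crit c q' = crit c l' ->
    param_deriv c 1 q' != param_deriv c 1 l'.
  by apply: H => //; rewrite l_gt0.
elim: l' q' => // l' IH [//|q']; rewrite ltnS => lq' q'q.
have {}lq' : (l' < q')%N by [].
have q'_gt0 : (0 < q')%N by apply: leq_ltn_trans lq'.
have y0 : crit c q' != 0 by exact: x0'.
have d0 : d%:R != 0 :> R by rewrite pnatr_eq0 -lt0n ltnW.
rewrite !critS => /addIr /eq_expr_opp[] xql'.
  have l'_gt0 : (0 < l')%N.
    by case: l' xql' {IH lq'} => // xq0; rewrite xq0 /crit /= eqxx in y0.
  rewrite /= /gderiv xql' -subr_eq0 opprD addrACA subrr add0r -mulrBr.
  rewrite mulf_neq0 ?subr_eq0 ?IH ?l'_gt0 ?(ltnW q'q) //.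
  by rewrite mul1r mulf_neq0 // expf_neq0 // -xql'.
have l'_gt0 : (0 < l')%N.
  by case: l' xql' {IH lq'} => // xq0; rewrite xq0 /crit /= oppr0 eqxx in y0.
have od : odd d.-1 by move: d_even; rewrite -{1}(prednK (ltnW d_ge2)) /= negbK.
have sgn y : (- y) ^+ d.-1 = - y ^+ d.-1 :> R by rewrite exprNn -signr_odd od mulN1r.
rewrite -subr_eq0 [X in X != 0](_ : _ =
    - (d%:R * crit c l' ^+ d.-1) * (param_deriv c 1 q' + param_deriv c 1 l')).
  rewrite mulf_neq0 ?(param_deriv_sum_neq0 rel0) ?l'_gt0 // oppr_eq0 mulf_neq0 //.
  by rewrite expf_neq0 // -oppr_eq0 -xql'.
by rewrite /= /gderiv xql' sgn; ring.
Qed.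

(* x^(i-1) times the parameter derivative at t = 1/x. *)
Fixpoint scaled_deriv c i : {poly R} :=
  if i is i'.+1 then 'X^i' + gderiv c i' *: scaled_deriv c i' else 0.

Lemma horner_scaled_deriv c i x : x != 0 ->
  (scaled_deriv c i.+1).[x] = x ^+ i * param_deriv c x^-1 i.+1.
Proof.
move=> x0; elim: i => [|i IH].
  by rewrite /= scaler0 addr0 expr0 hornerC !mulr0 addr0 mulr1.
rewrite [scaled_deriv _ _]/= -/(scaled_deriv c i.+1) hornerD hornerZ IH hornerXn.
rewrite [in RHS]/= -/(param_deriv c x^-1 i.+1) exprS.
by move: (param_deriv _ _ _) (gderiv _ _) (x ^+ i) => a b e; field.
Qed.

Lemma horner_scaled_deriv0 c i : (scaled_deriv c i.+1).[0] = orbit_deriv c i.+1.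
Proof.
elim: i => [|i IH].
  by rewrite /= scaler0 addr0 expr0 hornerC /orbit_deriv big_geq.
rewrite [scaled_deriv _ _]/= -/(scaled_deriv c i.+1) hornerD hornerZ IH hornerXn.
by rewrite expr0n /= add0r /orbit_deriv [in RHS]big_nat_recr //= mulrC.
Qed.

Lemma orbit_deriv_neq0 c l q : critical_relation c l q -> orbit_deriv c q != 0.
Proof.
move=> [_ _ x0]; rewrite /orbit_deriv prodf_seq_neq0; apply/allP => i.
rewrite mem_index_iota => iq /=; rewrite /gderiv mulf_neq0 ?pnatr_eq0 -?lt0n ?(ltnW d_ge2) //.
by rewrite expf_neq0 // x0.
Qed.

(** By [param_deriv_neq] and [param_deriv1_neq] the polynomial G has no zero in ]0, 1], so G(1) =
    V_q - V_l has the sign of G(0) = Dg^(q-1)(c). *)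
Lemma transversality_gt0 c l q : critical_relation c l q ->
  0 < (param_deriv c 1 q - param_deriv c 1 l) / orbit_deriv c q.
Proof.
move=> rel; have [lq _ _] := rel.
have [q' qE] : exists q', q = q'.+1 by exists q.-1; rewrite prednK // (leq_ltn_trans _ lq).
(* The power of ['X] aligns both terms at exponent q - 1 and, since l < q, removes the second one at
   0. *)
pose G := scaled_deriv c q - 'X^(q - l) * scaled_deriv c l.
have G0 : G.[0] = orbit_deriv c q.
  rewrite hornerD hornerN hornerM hornerXn expr0n subn_eq0 leqNgt lq mul0r subr0.
  by rewrite qE horner_scaled_deriv0.
have Gx x : x != 0 -> G.[x] = x ^+ q' * (param_deriv c x^-1 q - param_deriv c x^-1 l).
  move=> x0; rewrite hornerD hornerN hornerM hornerXn qE horner_scaled_deriv // mulrBr.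
  congr (_ - _); case: l lq {rel G G0} => [|l] lq; first by rewrite /= horner0 !mulr0.
  rewrite horner_scaled_deriv // mulrA -exprD; congr (_ ^+ _ * _).
  by move: lq; rewrite qE; clear; lia.
have G1 : G.[1] = param_deriv c 1 q - param_deriv c 1 l.
  by rewrite Gx ?oner_eq0 // expr1n mul1r invr1.
have D0 := orbit_deriv_neq0 rel.
have G10 : G.[1] != 0 by rewrite G1 subr_eq0 param_deriv1_neq.
rewrite -G1 -G0 -(@pmulr_lgt0 _ (G.[0] ^+ 2)) ?exprn_even_gt0 //=; last by rewrite G0.
rewrite expr2 mulrA divfK ?G0 // -G0.
rewrite lt_neqAle eq_sym mulf_neq0 ?G0 //= leNgt -G0 mulrC; apply/negP => neg.
have [x xI /rootP Gx0] := poly_ivtoo ler01 neg.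
have /andP[x0 x1] : 0 < x < 1 by move: xI; rewrite in_itv.
move: Gx0; rewrite Gx ?gt_eqF // => /eqP; rewrite mulf_eq0 expf_eq0 gt_eqF // andbF /=.
by rewrite subr_eq0 (negbTE (param_deriv_neq _ rel)) // invf_gt1.
Qed.

End CriticalOrbit.

(** * Derivatives of the iterates in the parameter and in the variable *)

Section Transversality.
Variables (R : realType) (d : nat).
Hypotheses (d_ge2 : (2 <= d)%N) (d_even : ~~ odd d).
Implicit Types (c : R) (n l q : nat).

Lemma g0 c : g d c 0 = c.
Proof. by rewrite /g expr0n gtn_eqF ?add0r // ltnW. Qed.

Lemma iter_g_crit c n : iter n (g d c) c = crit d c n.+1.
Proof. by rewrite /crit iterSr g0. Qed.

Lemma is_derive_param n c :
  is_derive c 1 (fun w : R => iter n (g d w) w) (param_deriv d c 1 n.+1).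
Proof.
elim: n => [|n IH].
  rewrite /= gderiv0 // !mulr0 addr0; exact: is_derive_id.
have -> : (fun w : R => iter n.+1 (g d w) w) =
          (fun w : R => iter n (g d w) w) ^+ d + id.
  by apply/funext => w; rewrite /= !fctE.
apply: is_derive_eq; rewrite [RHS]/= -/(param_deriv d c 1 n.+1) iter_g_crit.
by rewrite /gderiv mul1r /GRing.scale /= addrC mulr_natl.
Qed.

Lemma is_derive_iter_g n c :
  is_derive c 1 (iter n (g d c)) (orbit_deriv d c n.+1).
Proof.
elim: n => [|n IH].
  by rewrite /orbit_deriv big_geq //; exact: is_derive_id.
have -> : iter n.+1 (g d c) = (iter n (g d c)) ^+ d + cst c.
  by apply/funext => w; rewrite /= !fctE.
apply: is_derive_eq; rewrite addr0 iter_g_crit /orbit_deriv [RHS]big_nat_recr //=.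
by rewrite /gderiv /GRing.scale /= mulrC mulr_natl.
Qed.

Lemma positively_transversal_all c : positively_transversal d c.
Proof.
split=> [q [q0 xq x0]|nper l q /andP[l0 lq] xql].
  have rel : critical_relation d c 0 q.
    by split => // i iq; apply/eqP; exact: x0.
  have := transversality_gt0 d_ge2 d_even rel.
  rewrite subr0 /transversality_quotient /R_periodic !derive1E.
  case: q q0 {xq x0 rel} => // q _.
  by rewrite (@derive_val _ _ _ _ _ _ _ (is_derive_param q c))
    (@derive_val _ _ _ _ _ _ _ (is_derive_iter_g q c)).
have rel : critical_relation d c l q.
  split=> // i /andP[i0 _]; apply/eqP => xi; apply: nper.
  by exists i.
have := transversality_gt0 d_ge2 d_even rel.
rewrite /transversality_quotient /R_preperiodic !derive1E.
case: q lq {xql rel} => // q _; case: l l0 => // l _ /=.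
have D := is_deriveB (is_derive_param q c) (is_derive_param l c).
by rewrite (@derive_val _ _ _ _ _ _ _ D)
    (@derive_val _ _ _ _ _ _ _ (is_derive_iter_g q c)).
Qed.

End Transversality.

(** * Preimages of the critical point *)

Section PreimagesOfZero.
Variables (R : realType) (d : nat).
Hypotheses (d_ge2 : (2 <= d)%N) (d_even : ~~ odd d).
Implicit Types (c x y z : R) (s : bool) (w : seq bool) (n : nat).

Definition rootd x : R := x `^ d%:R^-1.

Lemma rootdK x : 0 <= x -> rootd x ^+ d = x.
Proof.
move=> x0; rewrite -powR_mulrn ?powR_ge0 // -powRrM mulVf ?powRr1 //.
by rewrite pnatr_eq0 -lt0n ltnW.
Qed.

Lemma rootd_gt0 x : 0 < x -> 0 < rootd x. Proof. exact: powR_gt0. Qed.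

(* The preimage of 0 under g_c^(size w) reached along the inverse branches
   whose signs are listed in w, and the condition for these to exist. *)
Fixpoint zpreim c w : R :=
  if w is s :: w' then (-1) ^+ s * rootd (zpreim c w' - c) else 0.

Fixpoint preim_ok c w : bool :=
  if w is s :: w' then preim_ok c w' && (c < zpreim c w') else true.

Lemma sgn_even s : ((-1) ^+ s) ^+ d = 1 :> R.
Proof. by case: s; rewrite ?expr1n // expr1 -signr_odd (negbTE d_even). Qed.

Lemma g_preim c s w : preim_ok c (s :: w) -> g d c (zpreim c (s :: w)) = zpreim c w.
Proof.
move=> /andP[_ cw]; rewrite /g /= exprMn sgn_even mul1r rootdK ?subrK //.
by rewrite subr_ge0 ltW.
Qed.

(** The strict inequality in [preim_ok] keeps these preimages off the critical point, which makes
    the coding by words injective. *)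
Lemma preim_neq0 c s w : preim_ok c (s :: w) -> zpreim c (s :: w) != 0.
Proof.
move=> /andP[_ cw]; rewrite /= mulf_neq0 ?signr_eq0 // gt_eqF // rootd_gt0 //.
by rewrite subr_gt0.
Qed.

Lemma preim_ok_drop c w i : preim_ok c w -> preim_ok c (drop i w).
Proof.
elim: w i => [|s w IH] [|i] // /andP[ok _]; rewrite drop_cons; exact: IH.
Qed.

Lemma iter_preim c w i : preim_ok c w -> (i <= size w)%N ->
  iter i (g d c) (zpreim c w) = zpreim c (drop i w).
Proof.
elim: i w => [|i IH] w ok; first by rewrite drop0.
case: w ok => // s w ok; rewrite ltnS => iw.
by rewrite iterSr g_preim // IH //; case/andP: ok.
Qed.

(** The word records the signs along the orbit up to its first visit to 0, hence may be shorter than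
    n. *)
Lemma preim_exists c n z : iter n (g d c) z = 0 ->
  exists w, [/\ preim_ok c w, (size w <= n)%N & zpreim c w = z].
Proof.
elim: n z => [|n IH] z; first by move=> /= ->; exists [::].
have [-> _|z0] := eqVneq z 0; first by exists [::].
rewrite iterSr => /IH[w [ok sw wz]].
have zd : zpreim c w - c = z ^+ d by rewrite wz /g addrK.
have zc : 0 < zpreim c w - c by rewrite zd exprn_even_gt0 // z0 orbT.
exists ((z < 0) :: w); split => //=; first by rewrite ok -subr_gt0.
have -> : rootd (zpreim c w - c) = `|z|.
  apply/eqP; rewrite -(@eqrXn2 _ d) ?normr_ge0 ?powR_ge0 //; last exact: ltnW.
  by rewrite rootdK ?ltW // zd -normrX ger0_norm // exprn_even_ge0.
by rewrite -[in RHS](mulr_sign_norm z).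
Qed.

Lemma preim_inj c w w' : preim_ok c w -> preim_ok c w' ->
  zpreim c w = zpreim c w' -> w = w'.
Proof.
elim: w w' => [|s w IH] [|s' w'] // ok ok'.
- by move=> /esym/eqP; rewrite (negbTE (preim_neq0 ok')).
- by move=> /eqP; rewrite (negbTE (preim_neq0 ok)).
- move=> E; have := congr1 (g d c) E; rewrite !g_preim // => Ew.
  case/andP: (ok) (ok') => okw cw /andP[okw' cw'].
  have {IH}ww : w = w' by exact: IH.
  rewrite -ww; congr (_ :: _); move: E; rewrite /= -ww => E.
  have r0 : rootd (zpreim c w - c) != 0 by rewrite gt_eqF // rootd_gt0 // subr_gt0.
  have := mulIf r0 E; case: s s' {E ok ok'} => [] [] //= /eqP.
    by rewrite expr0 expr1 eq_sym -addr_eq0 -mulr2n pnatr_eq0.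
  by rewrite expr0 expr1 -addr_eq0 -mulr2n pnatr_eq0.
Qed.

(** The c-derivative of [zpreim], by implicit differentiation of z^d + c = z', where z' is the
    preimage of the tail. *)
Fixpoint dpreim c w : R :=
  if w is s :: w' then (dpreim c w' - 1) / (d%:R * zpreim c w ^+ d.-1) else 0.

Lemma sgn_odd s x : ((-1) ^+ s * x) ^+ d.-1 = (-1) ^+ s * x ^+ d.-1.
Proof.
have od : odd d.-1 by move: d_even; rewrite -{1}(prednK (ltnW d_ge2)) /= negbK.
by rewrite exprMn -exprM mulnC exprM -(signr_odd _ d.-1) od expr1.
Qed.

Lemma is_derive_preim c w : preim_ok c w ->
  is_derive c 1 (fun x : R => zpreim x w) (dpreim c w).
Proof.
elim: w => [_|s w IH /andP[ok cw]] /=; first exact: is_derive_cst.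
have {}IH := IH ok.
have X0 : 0 < zpreim c w - c by rewrite subr_gt0.
have -> : (fun x : R => (-1) ^+ s * rootd (zpreim x w - x)) =
  (((-1) ^+ s : R) \*: ((fun x => x `^ d%:R^-1) \o (fun x : R => zpreim x w - x)))%R.
  by apply/funext.
have DX : is_derive c 1 (fun x : R => zpreim x w - x) (dpreim c w - 1).
  by apply: is_deriveB.
have DP := @is_derive1_powR R d%:R^-1 (zpreim c w - c) X0.
have DC : is_derive c 1 ((fun x => x `^ d%:R^-1) \o (fun x : R => zpreim x w - x))
  ((dpreim c w - 1) * (d%:R^-1 * (zpreim c w - c) `^ (d%:R^-1 - 1))).
  by rewrite mulrC; apply: is_derive1_comp.
apply: is_derive_eq; rewrite /GRing.scale /= sgn_odd.
have -> : (zpreim c w - c) `^ (d%:R^-1 - 1) = rootd (zpreim c w - c) / (zpreim c w - c).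
  rewrite powRB; last by rewrite (gt_eqF X0) implybT.
  by rewrite powRr1 ?ltW.
have r0 := rootd_gt0 X0; set r := rootd _ in r0 *.
have -> : zpreim c w - c = r * r ^+ d.-1.
  by rewrite -exprS prednK ?(ltnW d_ge2) // /r rootdK // ltW.
have dC : d%:R != 0 :> R by rewrite pnatr_eq0 -lt0n ltnW.
have rr : r ^+ d.-1 != 0 by rewrite expf_neq0 // gt_eqF.
have rn : r != 0 by rewrite gt_eqF.
move: (r ^+ d.-1) rr (dpreim c w) => u u0 e.
by case: s; rewrite ?expr1 ?expr0; field; rewrite ?u0 ?dC ?rn ?oner_eq0 ?oppr_eq0 ?oner_eq0.
Qed.

(* When g_c^(size w)(c) = 0 along w, transversality says that the preimage
   moves slower than the critical value. *)
Lemma dpreim_lt1 c w : preim_ok c w -> zpreim c w = c -> dpreim c w < 1.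
Proof.
move=> ok wc; set k := size w.
(* As the preimage is c itself, its orbit is the critical orbit, read off the suffixes of [w]. *)
have critE i : (i <= k)%N -> crit d c i.+1 = zpreim c (drop i w).
  by move=> ik; rewrite -iter_g_crit // -{2}wc iter_preim.
have rel : critical_relation d c 0 k.+1.
  split=> [//||[|i] // /andP[_ ik]].
    by rewrite critE // drop_size.
  rewrite critE; last exact: ltnW.
  rewrite (drop_nth false ik); apply: preim_neq0.
  by rewrite -(drop_nth false ik); exact: preim_ok_drop.
(* V and the velocities of the suffix preimages obey the same affine recursion, so their difference
   is multiplied by g'(x_(i+1)) at each step; for i = k the empty suffix has velocity 0. *)
have H i : (i <= k)%N -> param_deriv d c 1 i.+1 - dpreim c (drop i w) =
    orbit_deriv d c i.+1 * (1 - dpreim c w).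
  elim: i => [_|i IH ik].
    rewrite drop0 /= gderiv0 // !mulr0 addr0 /orbit_deriv big_geq // mul1r //.
  have D : dpreim c (drop i w) =
    (dpreim c (drop i.+1 w) - 1) / gderiv d c i.+1.
    by rewrite (drop_nth false ik) /gderiv critE ?(ltnW ik) // (drop_nth false ik).
  have g0 : gderiv d c i.+1 != 0.
    have [_ _ x0] := rel; rewrite /gderiv mulf_neq0 ?pnatr_eq0 -?lt0n ?(ltnW d_ge2) //.
    by rewrite expf_neq0 // x0.
  have -> : orbit_deriv d c i.+2 = orbit_deriv d c i.+1 * gderiv d c i.+1.
    by rewrite /orbit_deriv big_nat_recr.
  rewrite mulrAC -IH ?(ltnW ik) // [param_deriv d c 1 i.+2]/= -/(param_deriv d c 1 i.+1) D; move: (param_deriv d c 1 i.+1) => V.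
  by field.
have := transversality_gt0 d_ge2 d_even rel; rewrite subr0.
have := H k (leqnn k); rewrite drop_size subr0 => ->.
rewrite mulrAC mulfV ?mul1r ?subr_gt0 //.
exact: orbit_deriv_neq0 rel.
Qed.

End PreimagesOfZero.

(** * Functions that decrease at each of their zeros *)

Section Downcrossing.
Variable R : realType.

Lemma is_derive_lt0_right (f : R -> R) (m D : R) : is_derive m 1 f D -> D < 0 ->
  exists2 e : R, 0 < e & forall h, 0 < h < e -> f (m + h) < f m.
Proof.
move=> [df Df] D0.
have : h^-1 *: (f (h *: 1 + m) - f m) @[h --> 0^'] --> D by rewrite -Df; exact: df.
move=> /cvgr_lt/(_ 0 D0); rewrite /dnbhs /within /= => /nbhs_ballP[e /= e0 H].
exists e => // h /andP[h0 he].
have := H h; rewrite /ball /= sub0r normrN gtr0_norm // => /(_ he).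
rewrite gt_eqF // => /(_ isT).
rewrite /GRing.scale /= mulr1 pmulr_rlt0 ?invr_gt0 // subr_lt0.
by rewrite addrC.
Qed.

Lemma continuous_pos_near (f : R -> R) (m : R) : {for m, continuous f} -> 0 < f m ->
  exists2 e : R, 0 < e & forall x, `|m - x| < e -> 0 < f x.
Proof.
move=> cf f0; have : \forall x \near m, 0 < f x.
  exact: (@cvgr_gt R R (nbhs m) _ f (f m) cf 0 f0).
by move=> /nbhs_ballP[e /= e0 H]; exists e => // x xe; apply: H.
Qed.

(** At the last point m of [a, b] with f <= 0 one has m < b, and f is still negative just to the
    right of m: by the derivative if f(m) = 0, by continuity otherwise. *)
Lemma pos_of_decreasing_zeros (f : R -> R) (a b : R) : a <= b ->
  (forall x, a <= x <= b -> {for x, continuous f}) ->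
  (forall x, a <= x <= b -> f x = 0 -> exists2 D, D < 0 & is_derive x 1 f D) ->
  0 < f b -> 0 < f a.
Proof.
move=> ab cf df fb; rewrite ltNge; apply/negP => fa.
pose S := [set x | a <= x <= b /\ f x <= 0].
have Sa : S a by split=> //; rewrite lexx ab.
have Sb : ubound S b by move=> x [/andP[]].
have hS : has_sup S by split; [exists a|exists b].
pose m := sup S.
have am : a <= m by apply: ub_le_sup => //; exists b.
have mb : m <= b by apply: ge_sup => //; exists a.
have mab : a <= m <= b by rewrite am mb.
have fm : f m <= 0.
  rewrite leNgt; apply/negP => fm.
  have [e e0 He] := continuous_pos_near (cf m mab) fm.
  have [x [xab fx] mx] := sup_adherent e0 hS.
  have xm : x <= m by apply: ub_le_sup => //; exists b.
  have := He x; rewrite ger0_norm ?subr_ge0 // ltrBlDr -ltrBlDl => /(_ mx).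
  by rewrite ltNge fx.
have {}mb : m < b by rewrite lt_neqAle mb andbT; apply: contraTneq fb => <-; rewrite -leNgt.
have [x /andP[mx xb] fx] : exists2 x, m < x <= b & f x <= 0.
  have [fm0|fm0] := eqVneq (f m) 0.
    have [D D0 dfm] := df m mab fm0.
    have [e e0 He] := is_derive_lt0_right dfm D0.
    have e1 : 0 < Num.min (e / 2) (b - m) by rewrite lt_min divr_gt0 // subr_gt0.
    exists (m + Num.min (e / 2) (b - m)).
      rewrite ltrDl e1 /= -lerBrDl ge_min lexx orbT //.
    rewrite -fm0 ltW // He // e1 /= gt_min ltr_pdivrMr // ltr_pMr //.
    by rewrite ltr1n.
  have nfm : 0 < - f m by rewrite oppr_gt0 lt_neqAle fm0.
  have cnf : {for m, continuous (fun x => - f x)}.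
    by apply: cvgN; exact: cf.
  have [e e0 He] := continuous_pos_near cnf nfm.
  have e1 : 0 < Num.min (e / 2) (b - m) by rewrite lt_min divr_gt0 // subr_gt0.
  exists (m + Num.min (e / 2) (b - m)).
    rewrite ltrDl e1 /= -lerBrDl ge_min lexx orbT //.
  rewrite -oppr_ge0 ltW // He // opprD addrA subrr sub0r normrN gtr0_norm //.
  by rewrite gt_min ltr_pdivrMr // ltr_pMr // ltr1n.
have : x <= m.
  apply: ub_le_sup; first by exists b.
  by split => //; rewrite (ltW (le_lt_trans am mx)) xb.
by rewrite leNgt mx.
Qed.

End Downcrossing.

(** * Monotonicity of the set of realised words *)

Section PreimageMonotonicity.
Variables (R : realType) (d : nat).
Hypotheses (d_ge2 : (2 <= d)%N) (d_even : ~~ odd d).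
Implicit Types (c : R) (w : seq bool) (n : nat).

(** By induction the tail is realised on all of ]-oo, c'], where its preimage minus the parameter is
    differentiable and, by [dpreim_lt1], decreases at each zero; positivity at c' passes to c. *)
Lemma preim_ok_le c c' w : c <= c' -> preim_ok d c' w -> preim_ok d c w.
Proof.
elim: w c => // s w IH c cc' /andP[ok' cw'].
have ok x : x <= c' -> preim_ok d x w by move=> xc'; exact: IH.
rewrite /= ok //= -subr_gt0.
have DX x : x <= c' ->
    is_derive x 1 (fun x : R => zpreim d x w - x) (dpreim d x w - 1).
  by move=> /ok okx; have D := is_derive_preim d_ge2 d_even okx; apply: is_deriveB.
apply: (@pos_of_decreasing_zeros R (fun x => zpreim d x w - x) c c') => //.
- move=> x /andP[_ xc']; apply: differentiable_continuous.
  by apply/derivable1_diffP; have D := DX x xc'; apply: ex_derive.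
- move=> x /andP[_ xc'] /eqP; rewrite subr_eq0 => /eqP xw.
  exists (dpreim d x w - 1); last exact: DX.
  by rewrite subr_lt0 dpreim_lt1 // ok.
- by rewrite subr_gt0.
Qed.

Fixpoint words k : seq (seq bool) :=
  if k is k'.+1 then [::] :: [seq b :: w | b <- [:: true; false], w <- words k']
  else [::].

Lemma mem_words k w : (w \in words k) = (size w < k)%N.
Proof.
elim: k w => // k IH [|s w] //=.
rewrite inE /= ltnS -IH cats0 mem_cat.
have H b : (s :: w \in [seq b :: w0 | w0 <- words k]) = (s == b) && (w \in words k).
  apply/mapP/andP => [[u uk [-> ->]] //|[/eqP-> wk]]; by exists w.
by rewrite !H; case: (s); rewrite /= ?orbF.
Qed.

Lemma uniq_words k : uniq (words k).
Proof.
elim: k => // k IH /=; rewrite cats0 cat_uniq !map_inj_uniq ?IH //=; try by move=> u v [].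
rewrite mem_cat negb_or; apply/andP; split.
  by apply/andP; split; apply/mapP => -[].
by rewrite andbT; apply/hasPn => u /mapP[v _ ->]; apply/mapP => -[].
Qed.

(* The turning points of g_c^n. *)
Definition turning c n : seq R :=
  [seq zpreim d c w | w <- words n & preim_ok d c w].

Lemma turningP c n z :
  reflect (exists2 k, (k < n)%N & iter k (g d c) z = 0) (z \in turning c n).
Proof.
apply: (iffP mapP) => [[w + ->]|[k kn zk]].
  rewrite mem_filter mem_words => /andP[ok wn]; exists (size w) => //.
  by rewrite iter_preim // drop_size.
have [w [ok wk wz]] := preim_exists d_ge2 d_even zk.
by exists w => //; rewrite mem_filter mem_words ok (leq_ltn_trans wk).
Qed.

Lemma turning_uniq c n : uniq (turning c n).
Proof.
rewrite map_inj_in_uniq ?filter_uniq ?uniq_words // => w w'.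
rewrite !mem_filter => /andP[ok _] /andP[ok' _]; exact: preim_inj.
Qed.

Lemma size_turning_le c c' n : c <= c' -> (size (turning c' n) <= size (turning c n))%N.
Proof.
move=> cc'; rewrite !size_map !size_filter; apply: sub_count => w.
exact: preim_ok_le.
Qed.

End PreimageMonotonicity.

(** * Counting preimages *)

Section Counting.

Lemma count_ltn (T : eqType) (P Q : pred T) (t : seq T) (u : T) :
  (forall z, P z -> Q z) -> u \in t -> Q u -> ~~ P u ->
  (count P t < count Q t)%N.
Proof.
move=> PQ ut Qu Pu; have := count_predUI P (pred1 u) t.
have -> : count (predI P (pred1 u)) t = 0%N.
  apply/eqP; rewrite -leqn0 leqNgt -has_count; apply/hasPn => z _ /=.
  by apply/negP => /andP[Pz /eqP zu]; rewrite zu (negbTE Pu) in Pz.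
have u1 : (0 < count (pred1 u) t)%N by rewrite -has_count has_pred1.
rewrite addn0 => E; apply: (@leq_trans (count (predU P (pred1 u)) t)).
  by rewrite E -addn1 leq_add2l.
by apply: sub_count => z /= /orP[/PQ//|/eqP->].
Qed.

(** Sort [s]; the induction counts the elements of [t] beyond the head, and each gap of [s] uses up
    one of them. *)
Lemma size_interleaved (R : realDomainType) (s t : seq R) : uniq s ->
  (forall x y, x \in s -> y \in s -> x < y -> exists2 u, u \in t & x < u < y) ->
  (size s <= (size t).+1)%N.
Proof.
move=> us H; rewrite -(size_sort <=%R).
have : sorted <%R (sort <=%R s) by rewrite sort_lt_sorted.
have {H} : forall x y, x \in sort <=%R s -> y \in sort <=%R s -> x < y ->
    exists2 u, u \in t & x < u < y.
  by move=> x y; rewrite !mem_sort; exact: H.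
move: (sort _ _) => {us}s; case: s => // x s Hs ps.
rewrite /= ltnS; apply: leq_trans (count_size (fun u => x < u) t).
elim: s x Hs ps => // y s IH x Hs /= /andP[xy ps].
have [|||u ut /andP[xu uy]] := Hs x y; rewrite ?inE ?eqxx ?orbT //.
apply: (@leq_ltn_trans (count (fun u => y < u) t)).
  by apply: IH => // a b ay yb; apply: Hs; rewrite inE ?ay ?yb orbT.
by apply: (@count_ltn _ _ _ _ u) => //= [z /(lt_trans xy)//|]; rewrite -leNgt ltW.
Qed.

(** A duplicate-free list of maximal length exhausts P. *)
Lemma finite_enumeration (T : eqType) (P : T -> Prop) N :
  (forall s : seq T, uniq s -> (forall z, z \in s -> P z) -> (size s <= N)%N) ->
  exists s, [/\ uniq s, (size s <= N)%N & forall z, z \in s <-> P z].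
Proof.
move=> bd; pose Q n := `[< exists s : seq T, [/\ uniq s, size s = n & forall z, z \in s -> P z] >].
have Q0 : exists n, Q n by exists 0%N; apply/asboolP; exists [::].
have QN n : Q n -> (n <= N)%N by move/asboolP => [s [us <- sP]]; exact: bd.
have [n /asboolP[s [us sn sP]] nmax] := ex_maxnP Q0 QN.
exists s; split => // [|z]; first exact: bd.
split=> [|Pz]; first exact: sP.
apply/negPn/negP => zs; suff: (n.+1 <= n)%N by rewrite ltnn.
apply: nmax; apply/asboolP; exists (z :: s); rewrite /= zs us sn; split => // y.
by rewrite inE => /orP[/eqP->|/sP].
Qed.

End Counting.

(** * Iterates on the extended real line *)

Section IteratesOfExtension.
Variables (R : realType) (d : nat).
Hypotheses (d_ge2 : (2 <= d)%N) (d_even : ~~ odd d).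
Implicit Types (c x y z e : R) (n i : nat).

Lemma continuous_iter_g c n : continuous (iter n (g d c)).
Proof.
move=> x; apply: differentiable_continuous; apply/derivable1_diffP.
elim: n x => [|n IH] x; first exact: derivable_id.
have -> : iter n.+1 (g d c) = (iter n (g d c)) ^+ d + cst c.
  by apply/funext => w; rewrite /= !fctE.
by apply: derivableD => //; apply: derivableX.
Qed.

Lemma iter_g_IVT c n x y e : x <= y ->
  (iter n (g d c) x <= e <= iter n (g d c) y) \/
  (iter n (g d c) y <= e <= iter n (g d c) x) ->
  exists2 u, x <= u <= y & iter n (g d c) u = e.
Proof.
move=> xy H; have cf : {within `[x, y], continuous (iter n (g d c))}.
  by apply: continuous_subspaceT; exact: continuous_iter_g.
have [|u uxy ue] := IVT (v := e) xy cf.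
  by rewrite ge_min le_max; case: H => /andP[-> ->]; rewrite ?orbT.
by exists u => //; move: uxy; rewrite in_itv.
Qed.

(** Take the first iterate at which x and y merge: just before, their images are opposite and
    nonzero, so that iterate vanishes strictly between x and y. *)
Lemma turning_between c n x y : x < y -> iter n (g d c) x = iter n (g d c) y ->
  exists2 u, u \in turning d c n & x < u < y.
Proof.
elim: n => [|n IH] xy; first by move=> /= E; rewrite E ltxx in xy.
have [E _|ne E] := eqVneq (iter n (g d c) x) (iter n (g d c) y).
  have [u /(turningP d_ge2 d_even)[k kn ku] xuy] := IH xy E.
  by exists u => //; apply/turningP => //; exists k => //; exact: ltnW.
have {}E : iter n (g d c) x ^+ d = iter n (g d c) y ^+ d by exact: addIr E.
have [xy_eq|xNy] := eq_expr_opp d_ge2 E.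
  by rewrite xy_eq eqxx in ne.
have y0 : iter n (g d c) y != 0.
  by apply: contraNneq ne => y0; rewrite xNy y0 oppr0.
have [|u /andP[xu uy] u0] := @iter_g_IVT c n x y 0 (ltW xy).
  rewrite xNy oppr_le0 oppr_ge0; case: (lerP 0 (iter n (g d c) y)) => yy.
    by left.
  by right; rewrite ltW.
exists u; first by apply/turningP => //; exists n.
rewrite !lt_neqAle xu uy !andbT; apply/andP; split.
  by apply: contra_neq y0 => xu0; move: u0; rewrite -xu0 xNy => /eqP; rewrite oppr_eq0 => /eqP.
by apply: contra_neq y0 => <-.
Qed.

Lemma iter_g_preimages c n e : exists s : seq R,
  (size s <= (size (turning d c n)).+1)%N /\
  forall z, z \in s <-> iter n (g d c) z = e.
Proof.
have [|s [_ sN sP]] := @finite_enumeration R (fun z => iter n (g d c) z = e)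
    (size (turning d c n)).+1.
  move=> s us sP; apply: size_interleaved => // x y xs ys xy.
  by apply: turning_between => //; rewrite sP // sP.
by exists s.
Qed.

(** Beyond the escape radius 2 + |c|, g(u) >= |u|^2 - |c| >= |u|. *)
Lemma iter_g_ge c n z : 2 + `|c| <= `|z| -> `|z| <= iter n.+1 (g d c) z.
Proof.
move=> zc; have step u : 2 + `|c| <= `|u| -> `|u| <= g d c u.
  move=> uc; have u1 : 1 <= `|u| by have := normr_ge0 c; lra.
  have ud : `|u| ^+ 2 <= u ^+ d.
    rewrite -[leRHS]ger0_norm ?exprn_even_ge0 // normrX.
    exact: ler_weXn2l.
  have cN : - c <= `|c| by rewrite -normrN ler_norm.
  rewrite /g; have := normr_ge0 c; nra.
elim: n => [|n IH]; first exact: step.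
apply: le_trans (step _ _) => //=; first exact: le_trans IH (ler_norm _).
exact: le_trans zc (le_trans IH (ler_norm _)).
Qed.

Lemma iter_gext_fin c n z : iter n (g_ext d c) z%:E = (iter n (g d c) z)%:E.
Proof. by elim: n => //= n ->. Qed.

Lemma iter_gext_pinfty c n : iter n (g_ext d c) +oo%E = +oo%E.
Proof. by elim: n => //= n ->. Qed.

Lemma iter_gext_ninfty c n : iter n.+1 (g_ext d c) -oo%E = +oo%E.
Proof. by elim: n => [//|n IH]; rewrite iterS IH. Qed.

(** An infinite endpoint is replaced by a real one beyond B, where the iterate is already at least
    e. The identity, n = 0, is apart because it alone fixes -oo. *)
Lemma iter_gext_IVT c n (x y : \bar R) e : (x < y)%E ->
  (iter n (g_ext d c) x <= e%:E <= iter n (g_ext d c) y)%E \/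
  (iter n (g_ext d c) y <= e%:E <= iter n (g_ext d c) x)%E ->
  exists2 u, (x <= u%:E <= y)%E & iter n (g d c) u = e.
Proof.
case: n => [|n] xy.
  case=> /andP[xe ey]; first by exists e => //=; rewrite xe ey.
  by have := le_lt_trans (le_trans xe ey) xy; rewrite ltxx.
pose B := 2 + `|c| + `|e|.
have B0 : 0 <= B by rewrite /B; have := normr_ge0 c; have := normr_ge0 e; lra.
have Bc u : B <= `|u| -> e <= iter n.+1 (g d c) u.
  move=> Bu; apply: le_trans (iter_g_ge n _); last first.
    by apply: le_trans Bu; rewrite /B lerDl.
  apply: le_trans (ler_norm _) (le_trans _ Bu); rewrite /B.
  by have := normr_ge0 c; lra.
case: x xy => [x| |] xy H.
- case: y xy H => [y| |] // xy H.
    have [|u uxy ue] := @iter_g_IVT c n.+1 x y e (ltW xy).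
      by move: H; rewrite !iter_gext_fin !lee_fin.
    by exists u; rewrite ?lee_fin.
  move: H; rewrite iter_gext_pinfty iter_gext_fin => -[/andP[xe _]|/andP[]//].
  pose y := Num.max x B.
  have [||u /andP[xu _] ue] := @iter_g_IVT c n.+1 x y e.
  + by rewrite le_max lexx.
  + left; rewrite -lee_fin xe /= Bc // ger0_norm ?le_max ?lexx ?B0 ?orbT //.
  by exists u; rewrite // lee_fin xu leey.
- by case: y xy H.
- case: y xy H => [y| |] // xy; last first.
    by rewrite iter_gext_ninfty iter_gext_pinfty => -[] /andP[].
  rewrite iter_gext_ninfty iter_gext_fin => -[/andP[]//|/andP[ye _]].
  pose x := Num.min y (- B).
  have [||u /andP[_ uy] ue] := @iter_g_IVT c n.+1 x y e.
  + by rewrite ge_min lexx.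
  + right; rewrite -lee_fin ye /= Bc //.
    by rewrite ler0_norm ?ge_min ?oppr_le0 ?B0 ?orbT // lerNr ge_min lexx orbT.
  by exists u; rewrite // lee_fin uy leNye.
Qed.

End IteratesOfExtension.

(** * Covers and entropy *)

Section Covers.
Variables (R : realType) (T : topologicalType).
Implicit Types (W : set (set T)) (f : T -> T).

(** An indexed family, possibly with repetitions, is easier to build than a subset of given
    cardinality; the least k is the same. *)
Definition has_subcover W (k : nat) := exists F : nat -> set T,
  (forall i, (i < k)%N -> W (F i)) /\ forall x, exists2 i, (i < k)%N & F i x.

Lemma has_subcover_subset W V n : V `<=` W -> (V #= `I_n)%card ->
  cover V id = [set: T] -> has_subcover W n.
Proof.
move=> VW Vn Vc; have /card_set_bijP[F [FV _ Fs]] : (`I_n #= V)%card by rewrite card_eq_sym.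
exists F; split=> [i iN|x]; first by apply: VW; apply: FV.
have : cover V id x by rewrite Vc.
by case=> A VA Ax; have [i iN Fi] := Fs A VA; exists i => //; rewrite Fi.
Qed.

Lemma subset_of_has_subcover W k : has_subcover W k -> exists n V,
  [/\ (n <= k)%N, V `<=` W, (V #= `I_n)%card & cover V id = [set: T]].
Proof.
move=> [F [FW Fc]]; pose V := F @` `I_k.
have Vk : (V #<= `I_k)%card by exact: card_image_le.
have /finite_setP[n Vn] : finite_set V by apply: finite_image; exact: finite_II.
exists n, V; split => //.
- by rewrite -card_le_II -(card_le_eql Vn).
- by move=> _ [i ik <-]; exact: FW.
- apply/seteqP; split => // x _; have [i ik Fx] := Fc x.
  by exists (F i) => //; exists i.
Qed.

Lemma cover_number_attained W k : has_subcover W k -> exists n,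
  [/\ cover_number R W = n%:R%:E, has_subcover W n
    & forall k', has_subcover W k' -> (n <= k')%N].
Proof.
move=> Wk; pose Q n := `[< exists V,
  [/\ V `<=` W, (V #= `I_n)%card & cover V id = [set: T]] >].
have exQ : exists n, Q n.
  have [n [V [_ VW Vn Vc]]] := subset_of_has_subcover Wk.
  by exists n; apply/asboolP; exists V.
have [n /asboolP Qn nmin] := ex_minnP exQ; exists n; split.
- apply/eqP; rewrite eq_le; apply/andP; split.
    by apply: ereal_inf_lbound; exists n.
  apply: le_ereal_inf_tmp => _ [m Qm <-]; rewrite lee_fin ler_nat.
  by apply: nmin; apply/asboolP.
- by have [V [VW Vn Vc]] := Qn; exact: has_subcover_subset Vc.
- move=> k' /subset_of_has_subcover[m [V [mk VW Vm Vc]]].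
  by apply: leq_trans mk; apply: nmin; apply/asboolP; exists V.
Qed.

(** Submultiplicativity: a member for the first m steps is intersected with the pull-back of one for
    the next n; a pair of indices is coded as i1 k2 + i2. *)
Lemma has_subcover_iteratedD f W m n k1 k2 :
  has_subcover (iterated_cover f W m) k1 -> has_subcover (iterated_cover f W n) k2 ->
  has_subcover (iterated_cover f W (m + n)) (k1 * k2).
Proof.
move=> [F1 [F1W F1c]] [F2 [F2W F2c]].
exists (fun i => F1 (i %/ k2)%N `&` (iter m f @^-1` F2 (i %% k2)%N)); split.
  move=> i ik.
  have k2_gt0 : (0 < k2)%N by move: ik; case: (k2) => //; rewrite muln0.
  have i1 : (i %/ k2 < k1)%N by rewrite ltn_divLR.
  have i2 : (i %% k2 < k2)%N by rewrite ltn_mod.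
  have [A1 A1W E1] := F1W _ i1; have [A2 A2W E2] := F2W _ i2.
  exists (fun j => if (j < m)%N then A1 j else A2 (j - m)%N).
    move=> j jmn; case: ltnP => jm; first exact: A1W.
    by apply: A2W; rewrite ltn_subLR.
  rewrite -E1 -E2; apply/seteqP; split=> x /=.
    move=> H; split=> j /= jm.
      by have := H j; rewrite /= jm; apply; apply: ltn_addr.
    have := H (m + j)%N; rewrite /= ltn_add2l => /(_ jm).
    by rewrite ltnNge leq_addr /= addKn addnC iterD.
  move=> [H1 H2] j /= jmn; case: ltnP => jm; first exact: H1.
  have := H2 (j - m)%N; rewrite /= ltn_subLR // => /(_ jmn).
  by rewrite -iterD subnK.
move=> x; have [i1 i1k F1x] := F1c x; have [i2 i2k F2x] := F2c (iter m f x).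
exists (i1 * k2 + i2)%N.
  apply: (@leq_trans (i1.+1 * k2)); last by rewrite leq_mul2r i1k orbT.
  by rewrite mulSn addnC ltn_add2r.
have k2_gt0 : (0 < k2)%N by apply: leq_ltn_trans i2k.
by rewrite divnMDl // divn_small // addn0 modnMDl modn_small.
Qed.

End Covers.

(** * Subadditive sequences *)

Section Fekete.
Variable R : realType.

(** The limit is the infimum of a_n / n over n > 0: if M nearly attains it, then for n = q M + r,
    a_n <= q a_M + K, with K bounding all a_r for r < M. *)
Lemma fekete (a : nat -> R) : (forall n, 0 <= a n) ->
  (forall m n, a (m + n)%N <= a m + a n) ->
  exists L : R, n%:R^-1 * a n @[n --> \oo] --> L.
Proof.
move=> a0 aD; pose S := [set n.+1%:R^-1 * a n.+1 | n in [set: nat]].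
have Sinf : has_inf S.
  split; first by exists (1%:R^-1 * a 1%N); exists 0%N.
  by exists 0 => _ [n _ <-]; rewrite mulr_ge0 // invr_ge0.
exists (inf S); apply/cvgrPdist_le => e e0.
have e2 : 0 < e / 2 by rewrite divr_gt0.
have [_ [m _ <-] Hm] := inf_adherent e2 Sinf.
set M := m.+1 in Hm.
pose K := \sum_(r < M) a r.
have aK r : (r < M)%N -> a r <= K.
  by move=> rM; rewrite /K (bigD1 (Ordinal rM)) //= lerDl sumr_ge0.
have aq q r : a (q * M + r)%N <= q%:R * a M + a r.
  elim: q => [|q IH]; first by rewrite mul0n mul0r add0r.
  rewrite mulSn -addnA (le_trans (aD _ _)) // -natr1 mulrDl mul1r.
  by rewrite [q%:R * _ + _]addrC -addrA lerD2l.
pose N := (Num.bound (K / (e / 2))).+1.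
near=> n.
have nN : (N <= n)%N by near: n; exact: nbhs_infty_ge.
have n0 : (0 < n)%N by apply: leq_trans nN.
have nR : 0 < n%:R :> R by rewrite ltr0n.
have Ln : inf S <= n%:R^-1 * a n.
  apply: ge_inf; first by have [_ ?] := Sinf.
  by exists n.-1 => //; rewrite prednK.
rewrite ler0_norm ?subr_le0 // opprB lerBlDr.
have K0 : 0 <= K by rewrite sumr_ge0.
have Kn : K / n%:R <= e / 2.
  rewrite ler_pdivrMr // mulrC -ler_pdivrMr //.
  apply: (@le_trans _ _ N%:R); last by rewrite ler_nat.
  apply: le_trans (ltW (archi_boundP (divr_ge0 K0 (ltW e2)))) _.
  by rewrite ler_nat.
have nM : a n <= (n %/ M)%:R * a M + K.
  rewrite {1}(divn_eq n M) (le_trans (aq _ _)) // lerD2l aK // ltn_mod.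
  by [].
have qM : (n %/ M)%:R <= n%:R / M%:R :> R.
  by rewrite ler_pdivlMr ?ltr0n // -natrM ler_nat leq_trunc_div.
apply: (@le_trans _ _ (n%:R^-1 * (n%:R / M%:R * a M + K))).
  rewrite ler_wpM2l ?invr_ge0 ?ler0n // (le_trans nM) // lerD2r.
  by rewrite ler_wpM2r.
rewrite mulrDr !mulrA mulVf ?gt_eqF // mul1r [_ * K]mulrC.
have := ltW Hm; lra.
Unshelve. all: by end_near.
Qed.

End Fekete.

Section EntropyOfACover.
Variables (R : realType) (T : topologicalType) (f : T -> T) (U : set (set T)).
Variable x0 : T.
Hypothesis finite_subcovers : forall n, exists k, has_subcover (iterated_cover f U n) k.

(** Subadditivity of ln N(n) makes the [limn] of the definition a true limit; the point [x0] forces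
    N(n) > 0. *)
Lemma cover_entropy_limit : exists (N : nat -> nat) (L : R),
  [/\ forall n, has_subcover (iterated_cover f U n) (N n),
      forall n k, has_subcover (iterated_cover f U n) k -> (N n <= k)%N,
      forall n, (0 < N n)%N,
      cover_entropy R f U = L%:E
    & n%:R^-1 * ln ((N n)%:R : R) @[n --> \oo] --> L].
Proof.
have /choice[N HN] : forall n, exists k,
    [/\ cover_number R (iterated_cover f U n) = k%:R%:E,
        has_subcover (iterated_cover f U n) k
      & forall k', has_subcover (iterated_cover f U n) k' -> (k <= k')%N].
  by move=> n; have [k] := finite_subcovers n; exact: cover_number_attained.
have N0 n : (0 < N n)%N.
  have [_ [F [_ Fc]] _] := HN n; have [j jN _] := Fc x0.
  by apply: leq_ltn_trans jN.
have NR n : 0 < (N n)%:R :> R by rewrite ltr0n.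
have [||L HL] := @fekete R (fun n => ln ((N n)%:R : R)).
- by move=> n; rewrite ln_ge0 // ler1n.
- move=> m n; rewrite -lnM ?posrE // -natrM ler_ln ?posrE ?ltr0n ?muln_gt0 ?N0 //.
  rewrite ler_nat; have [_ _] := HN (m + n)%N; apply.
  have [_ cm _] := HN m; have [_ cn _] := HN n.
  exact: has_subcover_iteratedD.
exists N, L; split => //; try by move=> n; have [] := HN n.
rewrite /cover_entropy; apply: cvg_lim => //.
have -> : (fun n => (n%:R^-1)%:E * lne (cover_number R (iterated_cover f U n)))%E =
    (fun n => (n%:R^-1 * ln ((N n)%:R : R))%:E).
  by apply/funext => n; have [-> _ _] := HN n; rewrite lne_EFin // EFinM.
apply: cvg_EFin => //; exact: nearW.
Qed.

End EntropyOfACover.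

(** * Cover numbers bounded above by turning points *)

Section UpperBound.
Variables (R : realType) (d : nat).
Hypotheses (d_ge2 : (2 <= d)%N) (d_even : ~~ odd d).
Implicit Types (U : set (set (\bar R))) (E S : seq R) (y z : \bar R).

Definition same_side E y z := forall e, e \in E ->
  ((e%:E < y) = (e%:E < z) /\ (y < e%:E) = (z < e%:E))%E.

Lemma lebesgue_number U (M : R) : open_cover U -> exists2 r, 0 < r &
  forall x : R, -M <= x <= M -> exists A, U A /\ forall y : R, `|x - y| < r -> A y%:E.
Proof.
move=> [Uo Uc].
have cM : compact `[- M, M]%classic by exact: segment_compact.
have /compact_near_coveringP/(_ _ (0^'+) (fun r x => exists A,
  U A /\ forall y : R, `|x - y| < r -> A y%:E) _) := cM.
case.
  move=> x _.
  have : cover U id x%:E by rewrite Uc.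
  case=> A UA Ax.
  have xA : nbhs (x%:E : \bar R) A by apply: open_nbhs_nbhs; split => //; exact: Uo.
  have : nbhs x (fun y : R => A y%:E) := xA.
  move=> /nbhs_ballP[e /= e0 He].
  exists (ball x (e / 2), [set r | r < e / 2]) => /=.
    split; first by apply: nbhsx_ballx; rewrite divr_gt0.
    by apply: nbhs_right_lt; rewrite divr_gt0.
  move=> [x' r] /= [xx' re]; exists A; split => // y x'y.
  apply: He; rewrite /ball /= (splitr e).
  rewrite -(subrK x' x) -addrA (le_lt_trans (ler_normD _ _)) // ltrD //.
  exact: lt_trans re.
move=> r /= r0 Hr; exists (r / 2); first by rewrite divr_gt0.
move=> x xM; apply: (Hr (r / 2)) => //=.
- by rewrite sub0r normrN gtr0_norm ?divr_gt0 // ltr_pdivrMr // ltr_pMr // ltr1n.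
- by rewrite divr_gt0.
Qed.

(** Beyond [-M, M] one member around each infinity suffices; inside, a grid finer than the Lebesgue
    number keeps points that it does not separate in a common member. *)
Lemma refining_points U : open_cover U -> exists E, forall y, exists A, U A /\
  forall z, same_side E y z -> A z.
Proof.
move=> Ucov; have [Uo Uc] := Ucov.
have [Ap [UAp [Mp HMp]]] : exists A, U A /\ exists M : R, forall y, (M%:E < y)%E -> A y.
  have : cover U id +oo%E by rewrite Uc.
  case=> A UA Ap; exists A; split => //.
  have : nbhs (+oo%E : \bar R) A by apply: open_nbhs_nbhs; split => //; exact: Uo.
  by case=> M [_ HM]; exists M.
have [An [UAn [Mn HMn]]] : exists A, U A /\ exists M : R, forall y, (y < M%:E)%E -> A y.
  have : cover U id -oo%E by rewrite Uc.
  case=> A UA An; exists A; split => //.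
  have : nbhs (-oo%E : \bar R) A by apply: open_nbhs_nbhs; split => //; exact: Uo.
  by case=> M [_ HM]; exists M.
pose M := `|Mp| + `|Mn|.
have MpM : Mp <= M by rewrite (le_trans (ler_norm _)) // lerDl.
have MnM : - M <= Mn.
  by rewrite lerNl (le_trans (ler_norm _)) // normrN lerDr.
have [r r0 Hr] := lebesgue_number M Ucov.
pose h := r / 2; have h0 : 0 < h by rewrite divr_gt0.
have hr : h < r by rewrite ltr_pdivrMr // ltr_pMr // ltr1n.
pose K := (Num.trunc ((M + M) / h)).+1.
pose E := [:: - M, M & [seq - M + k%:R * h | k <- iota 0 K.+1]].
have grid x : - M <= x <= M -> exists e, e \in E /\ x < e <= x + h.
  move=> /andP[Mx xM]; pose k := (Num.trunc ((x + M) / h)).+1.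
  have x0 : 0 <= (x + M) / h by rewrite divr_ge0 ?(ltW h0) // -lerBlDr sub0r.
  have /andP[k1 k2] := truncn_itv x0.
  exists (- M + k%:R * h); split.
    rewrite 2!in_cons; apply/orP; right; apply/orP; right; apply/mapP; exists k => //.
    rewrite mem_iota /= add0n ltnS /k /K ltnS.
    by apply: Num.Theory.le_truncn; rewrite ler_pM2r ?invr_gt0 // lerD2r.
  apply/andP; split.
    by rewrite addrC ltrBrDr -ltr_pdivrMr.
  rewrite /k -natr1 mulrDl mul1r addrA lerD2r addrC lerBlDr -ler_pdivlMr //.
exists E => y.
have yE (e : R) z : e \in E -> same_side E y z ->
  (((e%:E < y) = (e%:E < z)) /\ ((y < e%:E) = (z < e%:E)))%E by move=> eE; apply.
have ME : M \in E by rewrite 2!in_cons eqxx /= orbT.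
have NME : - M \in E by rewrite in_cons eqxx.
have [My|yM] := ltP M%:E y.
  exists Ap; split => // z /(yE _ _ ME)[H _]; apply: HMp.
  by rewrite (le_lt_trans _ (_ : M%:E < z)%E) ?lee_fin // -H.
have [yNM|NMy] := ltP y (- M)%:E.
  exists An; split => // z /(yE _ _ NME)[_ H]; apply: HMn.
  by rewrite (lt_le_trans (_ : z < (- M)%:E)%E) ?lee_fin // -H.
case: y yE yM NMy => [y| |] yE yM NMy; [|by rewrite leNgt ltry in yM|by rewrite leNgt ltNyr in NMy].
rewrite !lee_fin in yM NMy.
have [|A [UA HA]] := Hr y; first by rewrite NMy yM.
exists A; split => // z yz.
have zM : (z <= M%:E)%E.
  by rewrite leNgt; have [<- _] := yE _ _ ME yz; rewrite -leNgt lee_fin.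
have NMz : ((- M)%:E <= z)%E.
  by rewrite leNgt; have [_ <-] := yE _ _ NME yz; rewrite -leNgt lee_fin.
case: z yz zM NMz => [z| |] yz zM NMz; [|by rewrite leNgt ltry in zM|by rewrite leNgt ltNyr in NMz].
rewrite !lee_fin in zM NMz.
apply: HA; rewrite ltNge; apply/negP => ryz.
have [yz'|zy] := lerP y z.
  have [|e [eE /andP[ye ey]]] := grid y; first by rewrite NMy yM.
  have [_] := yE e _ eE yz; rewrite !lte_fin ye => /esym.
  rewrite ltNge; case/negP; apply: le_trans ey _.
  move: ryz; rewrite distrC ger0_norm ?subr_ge0 // => ryz.
  by have := ltW hr; lra.
have [|e [eE /andP[ze ez]]] := grid z; first by rewrite NMz zM.
have [_] := yE e _ eE yz; rewrite !lte_fin ze ltNge => /negP; case; apply: le_trans ez _.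
move: ryz; rewrite ger0_norm ?subr_ge0 ?(ltW zy) // => ryz.
by have := ltW hr; lra.
Qed.

Lemma has_subcover_code (T : topologicalType) (W : set (set T)) (cl : T -> nat) K (x0 : T) :
  (forall x, (cl x < K)%N) ->
  (forall x, exists A, W A /\ forall x', cl x' = cl x -> A x') -> has_subcover W K.
Proof.
move=> clK H.
have /choice[F HF] : forall i, exists A, W A /\ forall x, cl x = i -> A x.
  move=> i; have [[x <-]|nx] := pselect (exists x, cl x = i); first exact: H.
  have [A [WA _]] := H x0; exists A; split => // x xi.
  by case: nx; exists x.
exists F; split=> [i _|x]; first by have [] := HF i.
by exists (cl x) => //; have [_] := HF (cl x); apply.
Qed.

(** A code for the partition of the line by S: even in the gaps, odd at the points of S. *)
Definition position S y : nat :=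
  (2 * count (fun s => (s%:E < y)%E) S + has (fun s => s%:E == y) S)%N.

Lemma position_lt S y : (position S y < 2 * size S + 2)%N.
Proof.
rewrite /position; have := count_size (fun s => (s%:E < y)%E) S.
by move: (count _ _) (size S) (has _ _) => a b [] /=; clear; lia.
Qed.

(** Equal counts exclude points of S in [y, z[; by parity, z in S would put y in S as well. *)
Lemma position_eq S y z : (y < z)%E -> position S y = position S z ->
  forall s, s \in S -> ~ (y <= s%:E <= z)%E.
Proof.
move=> yz; rewrite /position.
set a := count _ S; set a' := count (fun s => (s%:E < z)%E) S.
set b := has _ S; set b' := has _ S => ab.
have aa : a = a' by move: ab; clear; case: b b' => -[] /=; lia.
have bb : b = b' by move: ab aa; clear; case: b b' => -[] /=; lia.
have H s : s \in S -> ~~ (y <= s%:E < z)%E.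
  move=> sS; apply/negP => /andP[ys sz].
  suff : (a < a')%N by rewrite aa ltnn.
  apply: (@count_ltn _ _ _ _ s) => //= [t ty|]; first exact: lt_trans yz.
  by rewrite -leNgt.
move=> s sS /andP[ys sz]; have := H s sS; rewrite ys /= -leNgt => zs.
have szE : s%:E = z by apply/eqP; rewrite eq_le sz zs.
have : b' by apply/hasP; exists s => //; rewrite szE.
rewrite -bb => /hasP[t tS /eqP ty]; have := H t tS.
by rewrite ty lexx yz.
Qed.

Lemma size_flatten_le (T : Type) (B : nat) (ss : seq (seq T)) :
  all (fun s => (size s <= B)%N) ss -> (size (flatten ss) <= size ss * B)%N.
Proof.
elim: ss => //= s ss IH /andP[sB ssB]; rewrite size_cat mulSn leq_add //.
exact: IH.
Qed.

Lemma size_turning_mono (c : R) m n : (m <= n)%N ->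
  (size (turning d c m) <= size (turning d c n))%N.
Proof.
move=> mn; apply: uniq_leq_size; first exact: turning_uniq.
move=> z /(turningP d_ge2 d_even)[k km zk]; apply/turningP => //.
by exists k => //; apply: leq_trans mn.
Qed.

(** Let S collect the preimages of E under the first n iterates. By the intermediate value property,
    points in the same position relative to S have iterates on the same side of E, so positions code
    a subcover. *)
Lemma iterated_cover_upper (c : R) U : open_cover U -> exists C : nat, forall n,
  has_subcover (iterated_cover (g_ext d c) U n)
    (2 * (n * C * (size (turning d c n)).+1) + 2).
Proof.
move=> /refining_points[E HE]; exists (size E) => n.
have /choice[L HL] := fun p : nat * R => iter_g_preimages d_ge2 d_even c p.1 p.2.
pose S := flatten [seq L (i, e) | i <- iota 0 n, e <- E].
have sS : (size S <= n * size E * (size (turning d c n)).+1)%N.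
  have -> : (n * size E = size [seq L (i, e) | i <- iota 0 n, e <- E])%N.
    by rewrite size_allpairs size_iota.
  apply: size_flatten_le; apply/allP => s /allpairsP[[i e] /= [iI eE ->]].
  have [sL _] := HL (i, e); apply: leq_trans sL _; rewrite ltnS.
  by apply: size_turning_mono; rewrite mem_iota add0n in iI; exact: ltnW.
have SP i e u : (i < n)%N -> e \in E -> iter i (g d c) u = e -> u \in S.
  move=> iN eE ue; apply/flattenP; exists (L (i, e)).
    by apply/allpairsP; exists (i, e); rewrite mem_iota add0n.
  by have [_ H] := HL (i, e); apply/H.
have side y z i : (i < n)%N -> position S y = position S z ->
    same_side E (iter i (g_ext d c) y) (iter i (g_ext d c) z).
  move=> iN; have [->//|yz] := eqVneq y z.
  wlog : y z yz / (y < z)%E.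
    move=> H; have [lt_yz|lt_zy|yz_eq] := ltgtP y z; first exact: H.
    - by move=> /esym/(H _ _ _ lt_zy); rewrite eq_sym => /(_ yz) Hs e eE;
        have [-> ->] := Hs e eE.
    - by rewrite yz_eq eqxx in yz.
  move=> lt_yz pos e eE.
  have noS := position_eq lt_yz pos.
  set a := iter i _ y; set b := iter i _ z.
  have H1 : ~ ((a <= e%:E <= b)%E \/ (b <= e%:E <= a)%E).
    move=> /(iter_gext_IVT d_ge2 d_even lt_yz)[u uyz ue].
    by apply: (noS u) => //; exact: SP ue.
  have {}H1 : ~~ (a <= e%:E <= b)%E /\ ~~ (b <= e%:E <= a)%E.
    by split; apply/negP => ?; apply: H1; [left|right].
  case: H1; case: (ltgtP e%:E a); case: (ltgtP e%:E b) => //=.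
apply: (@has_subcover_code _ _ (position S) _ 0%E).
  by move=> x; apply: leq_trans (position_lt S x) _; rewrite leq_add2r leq_mul2l.
move=> y; have /choice[A HA] := fun i => HE (iter i (g_ext d c) y).
exists (\bigcap_(i in `I_n) (iter i (g_ext d c) @^-1` A i)); split.
  by exists A => // i _; have [] := HA i.
move=> z zy i /= iN; have [_] := HA i; apply.
by apply: side => //; exact: esym.
Qed.

End UpperBound.

(** * Cover numbers bounded below by turning points *)

Section LowerBound.
Variables (R : realType) (d : nat).
Hypotheses (d_ge2 : (2 <= d)%N) (d_even : ~~ odd d).
Implicit Types (c t u : R) (m n : nat).

Lemma seq_max_exists (s : seq R) : s != [::] ->
  exists2 t, t \in s & forall u, u \in s -> u <= t.
Proof.
elim: s => // a s IH _; have [->|/IH[t ts tmax]] := eqVneq s [::].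
  by exists a; rewrite ?mem_head // => u; rewrite inE => /eqP->.
have [at_|ta] := lerP a t.
  exists t; first by rewrite inE ts orbT.
  by move=> u; rewrite inE => /orP[/eqP->//|/tmax].
exists a; first exact: mem_head.
move=> u; rewrite inE => /orP[/eqP->//|/tmax ut]; exact: le_trans ut (ltW ta).
Qed.

Lemma open_seq_bigcap (T : topologicalType) (I : eqType) (s : seq I) (P : I -> set T) :
  (forall i, i \in s -> open (P i)) -> open [set x | forall i, i \in s -> P i x].
Proof.
elim: s => [_|a s IH Po].
  by rewrite [X in open X](_ : _ = setT); [exact: openT|apply/seteqP; split].
have -> : [set x | forall i, i \in a :: s -> P i x] =
    P a `&` [set x | forall i, i \in s -> P i x].
  apply/seteqP; split=> x /=.
    by move=> H; split=> [|i is_]; apply: H; rewrite inE ?eqxx ?is_ ?orbT.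
  by move=> [Pa Ps] i; rewrite inE => /orP[/eqP->|/Ps].
apply: openI; first exact/Po/mem_head.
by apply: IH => i is_; apply: Po; rewrite inE is_ orbT.
Qed.

(* The largest open interval meeting the turning points in t only. *)
Definition turning_nbhd c m t : set (\bar R) := [set x | forall s,
  s \in turning d c m -> ((s < t)%R -> s%:E < x)%E /\ ((t < s)%R -> x < s%:E)%E].

Definition turning_cover c m : set (set (\bar R)) :=
  turning_nbhd c m @` [set t | t \in turning d c m].

(** A point x lies in the neighbourhood of the largest turning point <= x or, failing that, of the
    smallest one; m > 0 makes 0 a turning point. *)
Lemma turning_cover_open c m : (0 < m)%N -> open_cover (turning_cover c m).
Proof.
move=> m0; split.
  move=> _ [t _ <-]; apply: open_seq_bigcap => s _.
  have [st|ts|->] := ltgtP s t.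
  - rewrite [X in open X](_ : _ = [set x | s%:E < x]%E); first exact: open_ereal_gt_ereal.
    by apply/seteqP; split=> x /=; [case=> H _; exact: H|move=> H; split].
  - rewrite [X in open X](_ : _ = [set x | x < s%:E]%E); first exact: open_ereal_lt_ereal.
    by apply/seteqP; split=> x /=; [case=> _ H; exact: H|move=> H; split].
  - by rewrite [X in open X](_ : _ = setT); [exact: openT|apply/seteqP; split].
apply/seteqP; split => // x _.
have T0 : 0 \in turning d c m by apply/turningP => //; exists 0%N.
have [L0|/seq_max_exists[t]] := eqVneq [seq s <- turning d c m | (s%:E <= x)%E] [::].
  have xs s : s \in turning d c m -> (x < s%:E)%E.
    move=> sT; rewrite ltNge; apply/negP => sx.
    suff : s \in [::] by [].
    by rewrite -L0 mem_filter sx.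
  have [|t] := @seq_max_exists [seq - s | s <- turning d c m].
    by case: (turning d c m) T0.
  case/mapP => t' t'T -> tmin; exists (turning_nbhd c m t'); first by exists t'.
  move=> s sT; split; last by move=> _; exact: xs.
  by rewrite ltNge -lerN2 tmin // map_f.
rewrite mem_filter => /andP[tx tT] tmax; exists (turning_nbhd c m t); first by exists t.
move=> s sT; split=> [st|ts]; first by apply: lt_le_trans tx; rewrite lte_fin.
rewrite ltNge; apply/negP => sx.
by have := tmax s; rewrite mem_filter sx sT leNgt ts => /(_ isT).
Qed.

(** Its three values produce the factor 3^n of [iterated_cover_lower]. *)
Definition side_of (t x : R) : option bool := if x == t then None else Some (x < t).

(** On either side of t the neighbourhood contains no turning point, so [turning_between] makes g^m
    injective there. *)
Lemma turning_nbhd_inj c m t x x' : t \in turning d c m -> x != x' ->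
  turning_nbhd c m t x%:E -> turning_nbhd c m t x'%:E ->
  side_of t x = side_of t x' ->
  x != t /\ iter m (g d c) x != iter m (g d c) x'.
Proof.
move=> tT xx' Bx Bx'; rewrite /side_of.
case: eqP => [xt|/eqP xt]; first by case: eqP => // x't; rewrite xt x't eqxx in xx'.
case: eqP => // /eqP x't [side]; split => //; apply/negP => /eqP E.
wlog lt_xx' : x x' xx' Bx Bx' xt x't side E / x < x'.
  move=> H; have [/H|/H|xE] := ltgtP x x'; first exact.
    by apply => //; rewrite eq_sym.
  by rewrite xE eqxx in xx'.
have [u uT /andP[xu ux']] := turning_between d_ge2 d_even lt_xx' E.
have [x't'|tx'] := ltP x' t.
  have [/(_ (lt_trans ux' x't')) + _] := Bx u uT.
  by rewrite lte_fin => /(lt_trans xu); rewrite ltxx.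
have tx : t < x.
  by rewrite lt_neqAle eq_sym xt leNgt side -leNgt.
have [_ /(_ (lt_trans tx xu))] := Bx' u uT.
by rewrite lte_fin => /(lt_trans ux'); rewrite ltxx.
Qed.

(** If z and z' differ, so do their images at all times m j, and none is a t_j. But z reaches 0 at
    some time k < m n, so with j = k / m rounded down its image at time m j is a turning point of
    g^m in the neighbourhood of t_j, which is t_j. *)
Lemma turning_code_inj c m n (t : nat -> R) z z' : (0 < m)%N ->
  (forall j, (j < n)%N -> [/\ t j \in turning d c m,
     turning_nbhd c m (t j) (iter (m * j) (g d c) z)%:E,
     turning_nbhd c m (t j) (iter (m * j) (g d c) z')%:E
   & side_of (t j) (iter (m * j) (g d c) z) = side_of (t j) (iter (m * j) (g d c) z')]) ->
  z \in turning d c (m * n) -> z = z'.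
Proof.
move=> m0 H /(turningP d_ge2 d_even)[k kmn zk].
apply/eqP; apply/negPn/negP => zz'.
have neq j : (j <= n)%N -> iter (m * j) (g d c) z != iter (m * j) (g d c) z'.
  elim: j => [|j IH] jn; first by rewrite muln0.
  have [tT Bz Bz' E] := H j jn.
  have [_] := turning_nbhd_inj tT (IH (ltnW jn)) Bz Bz' E.
  by rewrite -!iterD mulnS.
have jn : (k %/ m < n)%N by rewrite ltn_divLR // mulnC.
have [tT Bz Bz' E] := H _ jn.
have [xt _] := turning_nbhd_inj tT (neq _ (ltnW jn)) Bz Bz' E.
set x := iter _ _ z in xt Bz.
have xT : x \in turning d c m.
  apply/turningP => //; exists (k %% m)%N; first by rewrite ltn_mod.
  by rewrite /x -iterD addnC mulnC -divn_eq.
have [H1 H2] := Bz x xT.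
have [/H1|/H2|xt'] := ltgtP x (t (k %/ m)%N); rewrite ?ltxx //.
by rewrite xt' eqxx in xt.
Qed.

(** A turning point of g^(m n) is determined by a member of the subcover containing it and its sides
    at the n times m j. *)
Lemma iterated_cover_lower c m n k : (0 < m)%N ->
  has_subcover (iterated_cover (g_ext d c) (turning_cover c m) (m * n)) k ->
  (size (turning d c (m * n)) <= k * 3 ^ n)%N.
Proof.
move=> m0 [F [FW Fc]].
have /choice[idx Hidx] : forall z : R, exists i : 'I_k, F i z%:E.
  by move=> z; have [i ik Fz] := Fc z%:E; exists (Ordinal ik).
have /choice[t Ht] : forall i : 'I_k, exists t : nat -> R, forall j, (j < m * n)%N ->
    t j \in turning d c m /\ forall z : R, F i z%:E ->
      turning_nbhd c m (t j) (iter j (g d c) z)%:E.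
  move=> i; have [A AW AF] := FW i (ltn_ord i).
  have /choice[t Ht] : forall j, exists t, (j < m * n)%N ->
      t \in turning d c m /\ turning_nbhd c m t = A j.
    move=> j; have [jmn|jmn] := ltnP j (m * n); last by exists 0.
    by have [t tT tA] := AW j jmn; exists t.
  exists t => j jmn; have [tT tA] := Ht j jmn; split => // z.
  rewrite -AF => /(_ j jmn) /=; rewrite iter_gext_fin tA; exact.
pose code z : 'I_k * {ffun 'I_n -> option bool} :=
  (idx z, [ffun j : 'I_n => side_of (t (idx z) (m * j)%N) (iter (m * j) (g d c) z)]).
have code_inj : {in turning d c (m * n) &, injective code}.
  move=> z z' zT _ [/= ii /ffunP E].
  apply: (@turning_code_inj c m n (fun j => t (idx z) (m * j)%N)) => // j jn.
  have jmn : (m * j < m * n)%N by rewrite ltn_pmul2l.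
  have [tT tB] := Ht (idx z) _ jmn; split => //; first exact: tB.
    by apply: tB; rewrite ii.
  by have := E (Ordinal jn); rewrite !ffunE /= ii.
have Uc : uniq (map code (turning d c (m * n))).
  by rewrite map_inj_in_uniq // turning_uniq.
rewrite -(size_map code); move/card_uniqP: Uc => <-.
apply: leq_trans (max_card _) _.
by rewrite card_prod card_ord card_ffun card_ord card_option card_bool.
Qed.

End LowerBound.

(** * Comparison of entropies *)

Section EntropyMonotonicity.
Variables (R : realType) (d : nat).
Hypotheses (d_ge2 : (2 <= d)%N) (d_even : ~~ odd d).

Lemma finite_subcovers_g_ext (c : R) U : open_cover U ->
  forall n, exists k, has_subcover (iterated_cover (g_ext d c) U n) k.
Proof. by move=> /(iterated_cover_upper d_ge2 d_even c)[C HC] n; eexists; exact: HC. Qed.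

Lemma ln_le_linear (e x : R) : 0 < e -> 0 < x -> ln x <= e * x - ln e.
Proof.
move=> e0 x0; rewrite lerBrDl -lnM ?posrE // ltW // ln_sublinear //.
exact: mulr_gt0.
Qed.

(** Any cover U at c' is compared with the turning cover of g_c^m at c: the rates satisfy L' <= L +
    ln 3 / m + e, and m is then taken large. *)
Lemma entropy_le (c c' : R) : c <= c' ->
  (topological_entropy R (g_ext d c') <= topological_entropy R (g_ext d c))%E.
Proof.
move=> cc'; apply: ub_ereal_sup => _ [U Uo <-].
have [N' [L' [N'c N'min N'0 -> HL']]] :=
  cover_entropy_limit R 0%E (finite_subcovers_g_ext c' Uo).
have [C HC] := iterated_cover_upper d_ge2 d_even c' Uo.
set h := topological_entropy R (g_ext d c).
have key m e : (0 < m)%N -> 0 < e -> exists2 L, (L%:E <= h)%E & L' <= L + ln 3 / m%:R + e.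
  move=> m0 e0; have Vo := turning_cover_open d_ge2 d_even c m0.
  have [N [L [Nc Nmin N0 LE HL]]] := cover_entropy_limit R 0%E (finite_subcovers_g_ext c Vo).
  exists L; first by rewrite -LE; apply: ereal_sup_ubound; exists (turning_cover d c m).
  have e4 : 0 < e / 4 by rewrite divr_gt0.
  have [P1 _ HP1] := (@cvgrPdist_le _ _ _ _ _ _ _).1 HL' _ e4.
  have [P2 _ HP2] := (@cvgrPdist_le _ _ _ _ _ _ _).1 HL _ e4.
  pose K := ln (4 * C + 2)%:R - ln (e / 4).
  (* Then p = m n passes both convergence thresholds and K <= (e / 4) p. The four quarters of e pay
     for the two limits, for K / p and for the linear bound of ln p. *)
  pose n := (maxn P1 P2 + Num.bound (`|K| / (e / 4))).+1.
  pose p := (m * n)%N.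
  have np : (n <= p)%N by rewrite /p leq_pmull.
  have p0 : (0 < p)%N by apply: leq_trans np.
  have pR : 0 < p%:R :> R by rewrite ltr0n.
  have Pn : (maxn P1 P2 <= n)%N by apply: leqW; apply: leq_addr.
  have pP1 : (P1 <= p)%N by apply: leq_trans np; apply: leq_trans Pn; apply: leq_maxl.
  have pP2 : (P2 <= p)%N by apply: leq_trans np; apply: leq_trans Pn; apply: leq_maxr.
  have Kp : K <= e / 4 * p%:R.
    apply: le_trans (ler_norm _) _; rewrite -ler_pdivrMl // mulrC.
    have KK : 0 <= `|K| / (e / 4) by rewrite divr_ge0 // ltW.
    apply: le_trans (ltW (archi_boundP KK)) _; rewrite ler_nat.
    by apply: leq_trans np; apply: leqW; apply: leq_addl.
  have {}HP1 := HP1 p pP1; have {}HP2 := HP2 p pP2.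
  pose X := (N p * 3 ^ n)%N.
  have X0 : (0 < X)%N by rewrite muln_gt0 N0 expn_gt0.
  (* With T' and T the numbers of turning points at c' and c, N'(p) <= 2 p C (T' + 1) + 2 and T' <=
     T <= N(p) 3^n = X. *)
  have cnt : (N' p <= (4 * C + 2) * p * X)%N.
    apply: leq_trans (N'min _ _ (HC p)) _.
    have T'X : (size (turning d c' p) <= X)%N.
      apply: leq_trans (size_turning_le d_ge2 d_even p cc') _.
      exact: iterated_cover_lower (Nc p).
    apply: (@leq_trans (2 * (p * C * (X + X)) + 2 * (p * X))).
      apply: leq_add.
        by apply: leq_mul => //; apply: leq_mul => //; rewrite -addn1 leq_add.
      by rewrite leq_pmulr // muln_gt0 p0.
    by rewrite leq_eqVlt; apply/orP; left; apply/eqP; clear; lia.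
  have NR : ln (N' p)%:R <= K + e / 4 * p%:R + ln (N p)%:R + n%:R * ln 3 :> R.
    have NpR : 0 < (N p)%:R :> R by rewrite ltr0n.
    have CR : 0 < (4 * C + 2)%:R :> R by rewrite ltr0n addn2.
    have n3 : 0 < 3 ^+ n :> R by rewrite exprn_gt0.
    apply: (@le_trans _ _ (ln ((4 * C + 2) * p * X)%:R)).
      have cX := leq_trans (N'0 p) cnt.
      by rewrite ler_ln ?ler_nat // posrE ltr0n // N'0.
    have -> : ln ((4 * C + 2) * p * X)%:R =
        ln (4 * C + 2)%:R + ln p%:R + (ln (N p)%:R + n%:R * ln 3) :> R.
      rewrite [((4 * C + 2) * p * X)%:R]natrM [((4 * C + 2) * p)%:R]natrM.
      rewrite [X%:R]natrM natrX !lnM ?posrE ?mulr_gt0 //.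
      by rewrite lnXn // mulr_natl.
    move: (ln_le_linear e4 pR); rewrite /K.
    move: (ln p%:R) (e / 4 * p%:R) (n%:R * ln 3) (ln (4 * C + 2)%:R) (ln (N p)%:R) (ln (e / 4)).
    by clear=> a1 a2 a3 a4 a5 a6; lra.
  have A1 : L' <= p%:R^-1 * ln (N' p)%:R + e / 4.
    by move: HP1; rewrite ler_norml => /andP[_]; rewrite lerBlDr addrC.
  have A2 : p%:R^-1 * ln (N p)%:R <= L + e / 4.
    by move: HP2; rewrite ler_norml => /andP[]; rewrite lerNl opprB lerBlDl.
  apply: le_trans A1 _.
  have A3 : p%:R^-1 * ln (N' p)%:R <=
      e / 4 + e / 4 + p%:R^-1 * ln (N p)%:R + ln 3 / m%:R.
    rewrite ler_pdivrMl //; apply: le_trans NR _.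
    have mR : m%:R != 0 :> R by rewrite pnatr_eq0 -lt0n.
    have nR : n%:R != 0 :> R by rewrite pnatr_eq0.
    have -> : p%:R * (e / 4 + e / 4 + p%:R^-1 * ln (N p)%:R + ln 3 / m%:R) =
        e / 4 * p%:R + e / 4 * p%:R + ln (N p)%:R + n%:R * ln 3 :> R.
      move: (ln _%:R) (ln 3) => a b; rewrite /p natrM.
      by move: (n%:R) (m%:R) nR mR => x y x0 y0; field; rewrite x0 y0.
    by rewrite !lerD2r.
  lra.
have Lh L (e : R) : (L%:E <= h)%E -> h = e%:E -> L <= e.
  by move=> + hE; rewrite hE lee_fin.
case hE : h => [r| |]; last 2 first.
- by rewrite leey.
- by have [L] := key 1%N 1 isT ltr01; rewrite hE leNgt ltNyr.
rewrite lee_fin; apply/ler_addgt0Pr => e e0.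
have e2 : 0 < e / 2 by rewrite divr_gt0.
have l3 : 0 <= ln 3 :> R by rewrite ln_ge0 // ler1n.
pose m := (Num.bound (ln 3 / (e / 2) : R)).+1.
have [L /Lh/(_ hE) Lr L'L] := key m (e / 2) isT e2.
apply: le_trans L'L _.
have : ln 3 / m%:R <= e / 2.
  rewrite ler_pdivrMr ?ltr0n // -ler_pdivrMl // mulrC.
  have KK : 0 <= ln 3 / (e / 2) by rewrite divr_ge0 // ltW.
  apply: le_trans (ltW (archi_boundP KK)) _; rewrite ler_nat; exact: leqnSn.
lra.
Qed.

End EntropyMonotonicity.

Theorem corollary7p1 (R : realType) (d : nat) (hd2 : (2 <= d)%N)
    (hdeven : ~~ odd d) :
  (forall c1 : R, finite_set (forward_orbit (g d c1) 0) ->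
     positively_transversal d c1) /\
  ({homo (fun c : R => topological_entropy R (g_ext d c)) :
      c c' / c <= c' >-> (c <= c')%E} \/
   {homo (fun c : R => topological_entropy R (g_ext d c)) :
      c c' / c <= c' >-> (c' <= c)%E}).
Proof.
split; first by move=> c1 _; exact: positively_transversal_all.
by right=> c c' cc'; exact: entropy_le.
Qed.
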